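(* Let $f:\mathbb{R}^n\to\mathbb{R}$ and $g:\mathbb{R}^n\to\mathbb{R}^m$ be twice continuously differentiable, let $\Lambda\subseteq\mathbb{R}^m$ be closed, and let $\bar x$ be a local optimal solution of the problem (P): $\min f(x)$ s.t. $g(x)\in\Lambda$. Suppose that $d\in C(\bar x)$ satisfies $T^2_\Lambda(g(\bar x);\nabla g(\bar x)d)\ne\emptyset$ and the directional Robinson's constraint qualification in direction $d$: $$\nabla g(\bar x)^T\lambda=0,\ \lambda\in N^c_\Lambda(g(\bar x);\nabla g(\bar x)d)\ \Longrightarrow\ \lambda=0.$$ Then for every nonempty convex subset $C\subseteq T^2_\Lambda(g(\bar x);\nabla g(\bar x)d)$ there is some $\lambda\in\Lambda^c(\bar x;d)$ such that $$\nabla^2_{xx}L(\bar x,\lambda)(d,d)-\sigma_C(\lambda)\ge0.$$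
   Context: $\nabla g(x)\in\mathbb{R}^{m\times n}$ is the Jacobian, $\nabla f(x)$ is viewed as a row vector. The Lagrangian is $L(x,\lambda):=f(x)+g(x)^T\lambda$; $\nabla_xL$ is its gradient in $x$ and $\nabla^2_{xx}L(\bar x,\lambda)(d,d)=d^T\nabla^2_{xx}L(\bar x,\lambda)d$. For $x\in S$, $T_S(x):=\{d: \exists t_k\downarrow0,\ d_k\to d,\ x+t_kd_k\in S\}$; for $d\in T_S(x)$, $T^2_S(x;d):=\{w:\exists t_k\downarrow 0,\ w_k\to w,\ x+t_kd+\tfrac12t_k^2w_k\in S\}$. Critical cone: $C(\bar x):=\{d:\nabla g(\bar x)d\in T_\Lambda(g(\bar x)),\ \nabla f(\bar x)d\le0\}$. For $x\in S$, $\widehat N_S(x):=\{v:\langle v,x'-x\rangle\le o(\|x'-x\|)\ \forall x'\in S\}$ (empty if $x\notin S$). Directional limiting normal cone: $N_S(x;d):=\{v:\exists t_k\downarrow0,\ d_k\to d,\ v_k\to v,\ v_k\in\widehat N_S(x+t_kd_k)\}$. Directional Clarke normal cone: $N^c_S(x;d):=\mathrm{cl}\,\mathrm{co}\,N_S(x;d)$ (closed convex hull). Directional Clarke multiplier set: $\Lambda^c(\bar x;d):=\{\lambda:\nabla_xL(\bar x,\lambda)=0,\ \lambda\in N^c_\Lambda(g(\bar x);\nabla g(\bar x)d)\}$. Support function: $\sigma_C(\lambda):=\sup\{\lambda^Tu:u\in C\}$. *)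

(* Defs.v *)
(* Vectors of R^n are row vectors 'rV[R]_n, the convention
   of the library's jacobian: jacobian h x : 'M_(n, m) is the transpose of the
   usual m x n Jacobian matrix, so that h'(x) d is written d *m jacobian h x. *)
From HB Require Import structures.
From mathcomp Require Import all_boot all_order all_algebra.
From mathcomp Require Import all_classical all_reals all_analysis.

Set Implicit Arguments.
Unset Strict Implicit.
Unset Printing Implicit Defensive.
Import Order.TTheory GRing.Theory Num.Theory.
Import numFieldNormedType.Exports.
Local Open Scope classical_set_scope.
Local Open Scope ring_scope.

Section Defs.
Context {R : realType}.

Definition dot {n} (u v : 'rV[R]_n) : R := \sum_i u ord0 i * v ord0 i.

Definition grad {n} (h : 'rV[R]_n -> R) (x : 'rV[R]_n) : 'rV[R]_n :=
  \row_i 'D_(delta_mx ord0 i) h x.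

Definition hess {n} (h : 'rV[R]_n -> R) (x : 'rV[R]_n) : 'M[R]_n :=
  jacobian (grad h) x.

(* Since R^n has finite dimension, continuity of the second derivative as a map
   into the bilinear maps is continuity of its value at each pair (u, v). *)
Definition twice_cont_diff {n} {W : normedModType R} (h : 'rV[R]_n -> W) :=
  [/\ forall x, differentiable h x,
      forall v x, differentiable (fun y => 'd h y v) x
    & forall u v, continuous (fun x => 'd (fun y => 'd h y v) x u)].

Definition lagrangian {n m} (f : 'rV[R]_n -> R) (g : 'rV[R]_n -> 'rV[R]_m)
  (x : 'rV[R]_n) (lam : 'rV[R]_m) : R := f x + dot (g x) lam.

Definition local_optimal {n m} (f : 'rV[R]_n -> R) (g : 'rV[R]_n -> 'rV[R]_m)
    (Lam : set 'rV[R]_m) (xbar : 'rV[R]_n) : Prop :=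
  Lam (g xbar) /\ \forall x \near xbar, Lam (g x) -> f xbar <= f x.

Section Cones.
Context {n : nat}.
Implicit Types (S : set 'rV[R]_n) (x d : 'rV[R]_n).

Definition pos_null_seq (t : nat -> R) : Prop :=
  (forall k, 0 < t k) /\ t @ \oo --> (0 : R).

(* Meaningful for x in S. *)
Definition tangent_cone S x : set 'rV[R]_n :=
  [set d | exists (t : nat -> R) (dk : nat -> 'rV[R]_n),
    [/\ pos_null_seq t, dk @ \oo --> d & forall k, S (x + t k *: dk k)]].

(* Meaningful for x in S and d in tangent_cone S x. *)
Definition tangent_set2 S x d : set 'rV[R]_n :=
  [set w | exists (t : nat -> R) (wk : nat -> 'rV[R]_n),
    [/\ pos_null_seq t, wk @ \oo --> w &
      forall k, S (x + t k *: d + (2^-1 * t k ^+ 2) *: wk k)]].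

(* The library's norm on 'rV[R]_n is the sup norm; all norms on R^n being
   equivalent, the o(|x' - x|) condition does not depend on this choice. *)
Definition regular_normal S x : set 'rV[R]_n :=
  [set v | S x /\ forall e : R, 0 < e ->
    \forall x' \near x, S x' -> dot v (x' - x) <= e * `|x' - x|].

Definition dir_normal S x d : set 'rV[R]_n :=
  [set v | exists (t : nat -> R) (dk vk : nat -> 'rV[R]_n),
    [/\ pos_null_seq t, dk @ \oo --> d, vk @ \oo --> v &
      forall k, regular_normal S (x + t k *: dk k) (vk k)]].

Definition convex_hull S : set 'rV[R]_n :=
  smallest (@convex_set R 'rV[R]_n) S.

Definition dir_clarke_normal S x d : set 'rV[R]_n :=
  closure (convex_hull (dir_normal S x d)).

Definition support_fun S (lam : 'rV[R]_n) : \bar R :=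
  ereal_sup [set (dot lam u)%:E | u in S].

End Cones.

Definition critical_cone {n m} (f : 'rV[R]_n -> R) (g : 'rV[R]_n -> 'rV[R]_m)
    (Lam : set 'rV[R]_m) (xbar : 'rV[R]_n) : set 'rV[R]_n :=
  [set d | tangent_cone Lam (g xbar) (d *m jacobian g xbar) /\
           dot (grad f xbar) d <= 0].

Definition dir_clarke_multipliers {n m} (f : 'rV[R]_n -> R)
    (g : 'rV[R]_n -> 'rV[R]_m) (Lam : set 'rV[R]_m) (xbar d : 'rV[R]_n) :
    set 'rV[R]_m :=
  [set lam | grad (fun x => lagrangian f g x lam) xbar = 0 /\
             dir_clarke_normal Lam (g xbar) (d *m jacobian g xbar) lam].

Definition dir_robinson_cq {n m} (g : 'rV[R]_n -> 'rV[R]_m)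
    (Lam : set 'rV[R]_m) (xbar d : 'rV[R]_n) : Prop :=
  forall lam : 'rV[R]_m, lam *m (jacobian g xbar)^T = 0 ->
    dir_clarke_normal Lam (g xbar) (d *m jacobian g xbar) lam -> lam = 0.

End Defs.

(* Main.v *)
Require Import Defs.
From HB Require Import structures.
From mathcomp Require Import all_boot all_order all_algebra.
From mathcomp Require Import all_classical all_reals all_analysis.
From mathcomp Require Import ring lra.
Import Order.TTheory GRing.Theory Num.Theory.
Import numFieldNormedType.Exports.
Local Open Scope classical_set_scope.
Local Open Scope ring_scope.

(** Write [J] for the derivative of [g] at [xbar], [N] for the limiting normals
    to [Lam] at [g xbar] in the direction [d J], [K] for the closed convex cone
    that they generate, and [q] for [g''(xbar)(d, d)].

    Primal part ([primal_second_order]).  If [w] is a second order tangent and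
    the acceleration [v] is such that [z = v J + q - w] is polar to [N], then
    [f'(xbar) v + f''(xbar)(d, d) >= 0].  The vector [w] comes with times [t] and
    points [g xbar + t d J + t^2/2 w + o(t^2)] of [Lam].  Shifting such a point
    by [t^2/2 z] leaves it at distance o(t^2) from [Lam], because no normal to
    [Lam] at a nearby point in the direction [d J] makes a definitely acute angle
    with [z] ([polar_shift]).  Hence [xbar + t d + t^2/2 v] is feasible up to o(t^2), and
    directional metric subregularity ([directional_subregularity]) moves it by
    o(t^2) to a feasible point, at which the local optimality of [xbar] is
    expanded to second order; the first order term is nonpositive since [d] is
    critical.  Both approximation lemmas minimize a penalized distance to [Lam]
    and observe that a nonzero residual is a regular normal; [normals_near]
    converts the hypotheses on limiting normals into uniform ones on these
    regular normals.

    Dual part ([conic_multiplier]).  By the primal part the linear function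
    [v |-> f'(xbar) v + f''(xbar)(d, d)] is nonnegative on all [v] with [v J + q]
    in [C + polar N], and this set is convex even though the whole second order
    tangent set need not be.  Separating the origin from the convex set of
    (constraint, cost) pairs gives a vector [(l, mu)]; the bipolar theorem puts
    [l] in [K], the constraint qualification forces [mu > 0], and [l / mu] is a
    multiplier that works for all [w] in [C] at once, which is the bound on the
    support function. *)

Set Implicit Arguments.
Unset Strict Implicit.
Unset Printing Implicit Defensive.

(** * Euclidean geometry of row vectors *)

Section DotProduct.
Context {R : realType}.

Lemma dotC n (u v : 'rV[R]_n) : dot u v = dot v u.
Proof. by apply: eq_bigr => i _; rewrite mulrC. Qed.

Lemma dotDl n (u v w : 'rV[R]_n) : dot (u + v) w = dot u w + dot v w.
Proof. by rewrite -big_split; apply: eq_bigr => i _; rewrite mxE mulrDl. Qed.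

Lemma dotZl n a (u w : 'rV[R]_n) : dot (a *: u) w = a * dot u w.
Proof. by rewrite mulr_sumr; apply: eq_bigr => i _; rewrite mxE mulrA. Qed.

Lemma dotDr n (u v w : 'rV[R]_n) : dot w (u + v) = dot w u + dot w v.
Proof. by rewrite dotC dotDl !(dotC w). Qed.

Lemma dotZr n a (u w : 'rV[R]_n) : dot w (a *: u) = a * dot w u.
Proof. by rewrite dotC dotZl (dotC w). Qed.

Lemma dotNl n (u w : 'rV[R]_n) : dot (- u) w = - dot u w.
Proof. by rewrite -scaleN1r dotZl mulN1r. Qed.

Lemma dotNr n (u w : 'rV[R]_n) : dot w (- u) = - dot w u.
Proof. by rewrite dotC dotNl dotC. Qed.

Lemma dot0l n (w : 'rV[R]_n) : dot 0 w = 0.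
Proof. by rewrite -(scale0r 0) dotZl mul0r. Qed.

Lemma dot0r n (w : 'rV[R]_n) : dot w 0 = 0.
Proof. by rewrite dotC dot0l. Qed.

Lemma dotBl n (u v w : 'rV[R]_n) : dot (u - v) w = dot u w - dot v w.
Proof. by rewrite dotDl dotNl. Qed.

Lemma dotBr n (u v w : 'rV[R]_n) : dot w (u - v) = dot w u - dot w v.
Proof. by rewrite dotDr dotNr. Qed.

Lemma dot_mulmx n m (v : 'rV[R]_n) (A : 'M[R]_(n, m)) (w : 'rV[R]_m) :
  dot (v *m A) w = dot v (w *m A^T).
Proof.
have dotE k (x y : 'rV[R]_k) : dot x y = (x *m y^T) ord0 ord0.
  by rewrite mxE; apply: eq_bigr => i _; rewrite mxE.
by rewrite !dotE trmx_mul trmxK mulmxA.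
Qed.

Lemma dot_delta n (u : 'rV[R]_n) i : dot u (delta_mx ord0 i) = u ord0 i.
Proof.
rewrite /dot (bigD1 i) //= big1 ?addr0 => [|j ji]; rewrite mxE ?eqxx ?mulr1//.
by rewrite (negbTE ji) mulr0.
Qed.

Lemma dot_row_mx n k (u u' : 'rV[R]_n) (v v' : 'rV[R]_k) :
  dot (row_mx u v) (row_mx u' v') = dot u u' + dot v v'.
Proof.
rewrite /dot big_split_ord; congr (_ + _); apply: eq_bigr => i _.
  by rewrite !row_mxEl.
by rewrite !row_mxEr.
Qed.

Lemma dot_ge0 n (u : 'rV[R]_n) : 0 <= dot u u.
Proof. by apply: sumr_ge0 => i _; rewrite -expr2 sqr_ge0. Qed.

Lemma ler_coord_norm n (u : 'rV[R]_n) i : `|u ord0 i| <= `|u|.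
Proof.
rewrite [leRHS]/Num.Def.normr/= mx_normrE.
exact: (le_bigmax _ (fun ij => `|u ij.1 ij.2|) (ord0, i)).
Qed.

Lemma ler_row_norm n (u : 'rV[R]_n) e :
  0 <= e -> (forall i, `|u ord0 i| <= e) -> `|u| <= e.
Proof.
move=> e0 ue; rewrite [leLHS]/Num.Def.normr/= mx_normrE.
by apply: bigmax_le => // -[i j] _ /=; rewrite (ord1 i).
Qed.

Lemma norm2_le_dot n (u : 'rV[R]_n) : `|u| ^+ 2 <= dot u u.
Proof.
have [->|u0] := eqVneq u 0; first by rewrite normr0 expr0n dot_ge0.
have /mx_norm_neq0 [[i j] /= uij] : mx_norm u != 0.
  by apply: contra_neq u0; exact: mx_norm_eq0.
rewrite [X in X ^+ 2]uij (ord1 i) real_normK ?num_real// /dot (bigD1 j)//= -expr2.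
by rewrite lerDl sumr_ge0 // => k _; rewrite -expr2 sqr_ge0.
Qed.

Lemma dot_eq0 n (u : 'rV[R]_n) : (dot u u == 0) = (u == 0).
Proof.
apply/idP/eqP => [/eqP u0|->]; last by rewrite dot0l.
apply/normr0_eq0/eqP; rewrite -sqrf_eq0 eq_le sqr_ge0 andbT -u0.
exact: norm2_le_dot.
Qed.

Lemma ler_norm_dot n (u v : 'rV[R]_n) : `|dot u v| <= n%:R * (`|u| * `|v|).
Proof.
rewrite (le_trans (ler_norm_sum _ _ _))//.
rewrite (@le_trans _ _ (\sum_(i < n) `|u| * `|v|))//.
  by apply: ler_sum => i _; rewrite normrM ler_pM// ler_coord_norm.
by rewrite sumr_const card_ord mulr_natl.
Qed.

Lemma ler_dot n (u v : 'rV[R]_n) : dot u v <= n%:R * (`|u| * `|v|).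
Proof. exact: le_trans (ler_norm _) (ler_norm_dot _ _). Qed.

Lemma dot_sqrB n (u v : 'rV[R]_n) :
  dot (u - v) (u - v) = dot u u - dot u v *+ 2 + dot v v.
Proof. by rewrite dotBl !dotBr (dotC v u); ring. Qed.

Lemma dot_sqrD n (u v : 'rV[R]_n) :
  dot (u + v) (u + v) = dot u u + dot u v *+ 2 + dot v v.
Proof. by rewrite dotDl !dotDr (dotC v u); ring. Qed.

(** The statement measures everything with the sup norm, but nearest points
    yield normals only for the Euclidean one. *)
Definition enorm n (u : 'rV[R]_n) : R := Num.sqrt (dot u u).

Lemma enorm_ge0 n (u : 'rV[R]_n) : 0 <= enorm u.
Proof. exact: sqrtr_ge0. Qed.

Lemma sqr_enorm n (u : 'rV[R]_n) : enorm u ^+ 2 = dot u u.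
Proof. by rewrite sqr_sqrtr ?dot_ge0. Qed.

Lemma enorm_gt0 n (u : 'rV[R]_n) : (0 < enorm u) = (u != 0).
Proof. by rewrite sqrtr_gt0 lt0r dot_ge0 dot_eq0 andbT. Qed.

Lemma norm_le_enorm n (u : 'rV[R]_n) : `|u| <= enorm u.
Proof.
by rewrite -(@ler_pXn2r _ 2)// ?nnegrE ?enorm_ge0// sqr_enorm norm2_le_dot.
Qed.

Lemma enorm_le_norm n (u : 'rV[R]_n) : enorm u <= n%:R * `|u|.
Proof.
rewrite -(@ler_pXn2r _ 2)// ?nnegrE ?enorm_ge0 ?mulr_ge0// sqr_enorm.
apply: le_trans (ler_dot _ _) _; rewrite -expr2 exprMn.
by rewrite ler_wpM2r ?sqr_ge0// -natrX ler_nat; case: (n) => // k; rewrite leq_pmull.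
Qed.

Lemma unit_norm_le1 n (u : 'rV[R]_n) : dot u u = 1 -> `|u| <= 1.
Proof. by move=> u1; rewrite (le_trans (norm_le_enorm _))// /enorm u1 sqrtr1. Qed.

Lemma dot_normalize n (u : 'rV[R]_n) :
  u != 0 -> dot ((enorm u)^-1 *: u) ((enorm u)^-1 *: u) = 1.
Proof.
rewrite -enorm_gt0 => u0; rewrite dotZl dotZr -sqr_enorm mulrA -expr2 -exprMn.
by rewrite mulVf ?expr1n// gt_eqF.
Qed.

Lemma ler_norm_mulmx n m (A : 'M[R]_(n, m)) :
  exists2 L : R, 0 < L & forall v : 'rV[R]_n, `|v *m A| <= L * `|v|.
Proof.
exists (1 + n%:R * `|A^T|) => [|v]; first by rewrite ltr_pwDl// mulr_ge0.
apply: ler_row_norm => [|i]; first by rewrite mulr_ge0// addr_ge0// mulr_ge0.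
rewrite -dot_delta dot_mulmx (le_trans (ler_norm_dot _ _))// mulrDl mul1r.
rewrite (@le_trans _ _ (n%:R * `|A^T| * `|v|))// ?lerDr// -mulrA ler_wpM2l//.
rewrite mulrC ler_wpM2r//; apply: ler_row_norm => // j.
rewrite -rowE mxE [leRHS]/Num.Def.normr/= mx_normrE.
exact: (le_bigmax _ (fun ij => `|A^T ij.1 ij.2|) (i, j)).
Qed.

Lemma continuous_dot n (T : topologicalType) (F G : T -> 'rV[R]_n) :
  continuous F -> continuous G -> continuous (fun x => dot (F x) (G x)).
Proof.
move=> cF cG; apply: continuous_big => [|i _ x]; first exact: add_continuous.
by apply: cvgM; [apply: (@continuous_comp _ _ _ F (fun M : 'rV__ => M ord0 i))
  | apply: (@continuous_comp _ _ _ G (fun M : 'rV__ => M ord0 i))];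
  (exact: cF || exact: cG || exact: coord_continuous).
Qed.

Lemma continuous_enorm n (T : topologicalType) (F : T -> 'rV[R]_n) :
  continuous F -> continuous (fun x => enorm (F x)).
Proof.
move=> cF x; apply: (@continuous_comp _ _ _ (fun x => dot (F x) (F x))).
  exact: (continuous_dot cF cF).
exact: sqrt_continuous.
Qed.

End DotProduct.

(** * Nearest points and regular normals *)

Lemma near_radiusP (R : realType) (V : normedModType R) (x : V) (P : V -> Prop) :
  (\forall y \near x, P y) <->
  exists2 e, 0 < e & forall y, `|y - x| < e -> P y.
Proof.
split=> [/nbhs_normP[e /= e0 eP]|[e e0 eP]].
  by exists e => // y yx; apply: eP; rewrite /= distrC.
by apply/nbhs_normP; exists e => //= y yx; apply: eP; rewrite distrC.
Qed.

Section NearestPoints.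
Context {R : realType}.

Lemma closed_sublevel (T : topologicalType) (F : T -> R) r :
  continuous F -> closed [set x | F x <= r].
Proof. by move=> cF; apply: (preimage_closed _ (@closed_le R r)) => x _; exact: cF. Qed.

Lemma compact_ball n (x : 'rV[R]_n) r : compact [set y | `|y - x| <= r].
Proof.
apply: bounded_closed_compact.
  exists (`|x| + r); split=> [|M rM y /= yx]; first exact: num_real.
  rewrite (le_trans _ (ltW rM))// -(subrK x y) (le_trans (ler_normD _ _))//.
  by rewrite addrC lerD.
apply: (@closed_sublevel 'rV[R]_n (fun y => `|y - x|) r).
move=> y; apply: continuous_comp; last exact: norm_continuous.
by apply: continuousB; [exact: cvg_id|exact: cst_continuous].
Qed.

(** The first argument ranges over a compact set; for the second one, closedness
    suffices because values below the reference value confine it to a ball. *)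
Lemma exists_min (T : topologicalType) n (K : set T) (S : set 'rV[R]_n)
    (F : T * 'rV[R]_n -> R) x0 y0 M :
  compact K -> closed S -> continuous F -> K x0 -> S y0 ->
  (forall x u, K x -> S u -> F (x, u) <= F (x0, y0) -> `|u - y0| <= M) ->
  exists x u, [/\ K x, S u &
    forall x' u', K x' -> S u' -> F (x, u) <= F (x', u')].
Proof.
move=> cK cS cF Kx0 Sy0 FM.
have M0 : 0 <= M by rewrite (le_trans _ (FM _ _ Kx0 Sy0 _)).
pose D := S `&` [set u | `|u - y0| <= M].
have cD : compact D.
  apply: (subclosed_compact _ (@compact_ball _ y0 M)); last by move=> u [].
  by apply: closedI => //; apply: compact_closed (@compact_ball _ _ _).
have Dy0 : D y0 by split => //=; rewrite subrr normr0.
have [||[x u] /[!inE] -[/= Kx [Su _]] minxu] :=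
    @compact_EVT_min _ R F (K `*` D) _ (compact_setX cK cD).
- by exists (x0, y0).
- exact: continuous_subspaceT.
exists x, u; split => // x' u' Kx' Su'.
have Fxu0 : F (x, u) <= F (x0, y0) by apply: minxu; rewrite inE.
have [Fx'|/ltW] := leP (F (x', u')) (F (x0, y0)); last exact: le_trans.
by apply: minxu; rewrite inE; split => //; split => //; exact: FM Fx'.
Qed.

Lemma exists_nearest n (S : set 'rV[R]_n) p :
  closed S -> S !=set0 ->
  exists2 u, S u & forall u', S u' -> enorm (p - u) <= enorm (p - u').
Proof.
move=> cS [y Sy].
have [|||x [u [/= x0 Su umin]]] :=
    @exists_min R^o n [set 0] S (fun q => enorm (p - q.2)) 0 y
      (enorm (p - y) + enorm (p - y)) _ cS _ erefl Sy.
- exact: compact_set1.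
- by apply: continuous_enorm => q; apply: continuousB;
    [exact: cst_continuous|exact: cvg_snd].
- move=> _ u _ Su /= le; rewrite -(subrK p u) -addrA (le_trans (ler_normD _ _))//.
  by rewrite lerD ?norm_le_enorm// distrC (le_trans (norm_le_enorm _)).
by exists u => // u' Su'; rewrite (le_trans (umin 0 _ _ Su')).
Qed.

(** Expanding the square in |p - u|^2 <= |p - u'|^2 bounds the inner product of
    [p - u] and [u' - u] by |u' - u|^2 / 2, which is o(|u' - u|). *)
Lemma nearest_normal n (S : set 'rV[R]_n) p u :
  S u -> (forall u', S u' -> enorm (p - u) <= enorm (p - u')) ->
  regular_normal S u (p - u).
Proof.
move=> Su umin; split => // e e0; apply/near_radiusP.
have n0 : 0 < 1 + n%:R :> R by rewrite ltr_pwDl.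
exists (e / (1 + n%:R)); first by rewrite divr_gt0.
move=> u'; rewrite ltr_pdivlMr// => u'e Su'.
have : dot (p - u) (p - u) <= dot (p - u') (p - u').
  by rewrite -!sqr_enorm lerXn2r ?nnegrE ?enorm_ge0// umin.
have -> : p - u' = (p - u) - (u' - u) by rewrite opprB addrA subrK.
rewrite [leRHS]dot_sqrB => h.
have := ler_dot (u' - u) (u' - u); rewrite mulrA => h2.
have r0 := normr_ge0 (u' - u).
have := ler_wpM2r r0 (ltW u'e); have := mulr_ge0 (ltW e0) r0.
have := mulr_ge0 r0 r0.
lra.
Qed.
End NearestPoints.

(** * Directional limiting normals and nearby regular normals *)

Section NormalsNearDirection.
Context {R : realType}.

Lemma cvg_harmonic_bound (V : normedModType R) (v : nat -> V) l :
  (forall k, `|v k - l| <= k.+1%:R^-1) -> v @ \oo --> l.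
Proof.
move=> vl; apply/cvgrPdist_le => e e0.
have /cvgrPdist_le/(_ _ e0) := @cvg_harmonic R.
apply: filterS => k; rewrite sub0r normrN ger0_norm ?harmonic_ge0// => ke.
by rewrite distrC (le_trans (vl k)).
Qed.

Lemma compact_unit_sphere n : compact [set l : 'rV[R]_n | dot l l = 1].
Proof.
have cid : continuous (@id 'rV[R]_n) by move=> l; exact: cvg_id.
have cdot : continuous (fun l : 'rV[R]_n => dot l l).
  exact: (continuous_dot cid cid).
apply: (subclosed_compact _ (@compact_ball _ _ (0 : 'rV[R]_n) 1)).
  have -> : [set l : 'rV[R]_n | dot l l = 1] =
      [set l | dot l l <= 1] `&` [set l | - dot l l <= - 1].
    apply/seteqP; split=> l /= => [->//|[]].
    by rewrite lerN2 => h1 h2; apply/eqP; rewrite eq_le h1.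
  apply: closedI; apply: closed_sublevel => // l.
  exact: (cvgN (cdot l)).
by move=> l /=; rewrite subr0; exact: unit_norm_le1.
Qed.

(** The points approaching [a] from the direction [w], as they occur in the
    definition of directional normals, up to the tolerance [eps]. *)
Definition dir_near n (a w : 'rV[R]_n) eps t u : Prop :=
  [/\ 0 < t, t < eps & `|u - a - t *: w| <= eps * t].

(** Compactness of the unit sphere turns a strict condition on the directional
    limiting normals into a uniform one on the regular normals at all nearby
    points lying in that direction. *)
Lemma normals_near n (S : set 'rV[R]_n) a w (phi : 'rV[R]_n -> R) :
  continuous phi ->
  (forall l, dir_normal S a w l -> dot l l = 1 -> 0 < phi l) ->
  exists2 eps, 0 < eps & forall t u l,
    dir_near a w eps t u -> regular_normal S u l -> dot l l = 1 -> eps <= phi l.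
Proof.
move=> cphi phi0; apply/not_exists2P => bad.
(* A failure for every tolerance 1/(k+1) yields a sequence of unit normals. *)
have {}bad k : exists p : R * 'rV[R]_n * 'rV[R]_n,
    [/\ dir_near a w k.+1%:R^-1 p.1.1 p.1.2, regular_normal S p.1.2 p.2,
        dot p.2 p.2 = 1 & phi p.2 < k.+1%:R^-1].
  have [|/existsNP[t /existsNP[u /existsNP[l]]]] := bad k.+1%:R^-1.
    by rewrite invr_gt0.
  move=> /not_implyP[tu /not_implyP[ul /not_implyP[l1 /negP]]].
  by rewrite -ltNge => lk; exists (t, u, l).
have {bad}[p pP] := choice bad.
have [|l [/= l1 cl]] := @compact_unit_sphere n ((fun k => (p k).2) @ \oo).
  by exists 0%N => // k _ /=; case: (pP k).
(* The cluster point [l] is reached along a subsequence [s]. *)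
have sub j : exists k, (j <= k)%N /\ `|(p k).2 - l| <= j.+1%:R^-1.
  have [_ [[k /= jk <-]]] : [set (p k).2 | k in [set k | (j <= k)%N]] `&`
      [set x | `|x - l| < j.+1%:R^-1] !=set0.
    apply: cl; first by exists j => // k /= jk; exists k.
    by apply: (near_radiusP l _).2; exists j.+1%:R^-1; rewrite ?invr_gt0.
  by move=> /ltW kl; exists k.
have {cl sub}[s sP] := choice sub.
have sinv j : (s j).+1%:R^-1 <= j.+1%:R^-1 :> R.
  by rewrite lef_pV2 ?posrE// ler_nat ltnS; case: (sP j).
have : 0 < phi l.
  apply: phi0 => //.
  exists (fun j => (p (s j)).1.1),
    (fun j => ((p (s j)).1.1)^-1 *: ((p (s j)).1.2 - a)), (fun j => (p (s j)).2).
  split.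
  - split=> [j|]; first by have [[]] := pP (s j).
    apply: cvg_harmonic_bound => j; have [[t0 tj _] _ _ _] := pP (s j).
    by rewrite subr0 ger0_norm ?(ltW t0)// (le_trans (ltW tj)).
  - apply: cvg_harmonic_bound => j; have [[t0 _ tj] _ _ _] := pP (s j).
    rewrite -[w in X in X <= _](scalerK (lt0r_neq0 t0)) -scalerBr.
    rewrite normrZ gtr0_norm ?invr_gt0// mulrC ler_pdivrMr// (le_trans tj)//.
    by rewrite ler_wpM2r ?(ltW t0).
  - by apply: cvg_harmonic_bound => j; case: (sP j).
  - move=> j; have [[t0 _ _] + _ _] := pP (s j).
    by rewrite scalerA mulfV ?lt0r_neq0// scale1r addrC subrK.
have : (fun j => phi (p (s j)).2) @ \oo --> phi l.
  apply: (@continuous_cvg _ _ _ _ _ (fun j => (p (s j)).2)); first exact: cphi.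
  by apply: cvg_harmonic_bound => j; case: (sP j).
move=> cphil; apply/negP; rewrite -leNgt.
apply: (ler_cvg_to cphil (@cvg_harmonic R)); apply: nearW => j.
by have [_ _ _ /ltW h] := pP (s j); exact: le_trans h (sinv j).
Qed.

End NormalsNearDirection.

(** * Displacements polar to the directional normals *)

Section PolarShift.
Context {R : realType}.

Lemma regular_normalZ n (S : set 'rV[R]_n) u l c :
  0 < c -> regular_normal S u l -> regular_normal S u (c *: l).
Proof.
move=> c0 [Su ul]; split => // e e0.
apply: filterS (ul (e / c) (divr_gt0 e0 c0)) => u' h /h.
by rewrite dotZl mulrAC ler_pdivlMr// mulrC.
Qed.

Lemma nearest_unit_normal n (S : set 'rV[R]_n) p u :
  S u -> (forall u', S u' -> enorm (p - u) <= enorm (p - u')) -> p - u != 0 ->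
  regular_normal S u ((enorm (p - u))^-1 *: (p - u)).
Proof.
move=> Su umin pu0; apply: regular_normalZ; first by rewrite invr_gt0 enorm_gt0.
exact: nearest_normal.
Qed.

(** Dividing a first order inequality by the step and letting the step tend to
    zero, without mentioning limits. *)
Lemma ler_small_step (a b c : R) :
  0 < c -> 0 <= b -> (forall h, 0 < h -> h <= c -> a <= h * b) -> a <= 0.
Proof.
move=> c0 b0 ab; rewrite leNgt; apply/negP => a0.
pose h := Num.min c (a / (b + b + 1)).
have b1 : 0 < b + b + 1 by rewrite ltr_wpDl// addr_ge0.
have h0 : 0 < h by rewrite lt_min c0 divr_gt0.
have hc : h <= c by rewrite ge_min lexx.
have : h <= a / (b + b + 1) by rewrite ge_min lexx orbT.
rewrite ler_pdivlMr//; have := ab _ h0 hc; have := mulr_ge0 (ltW h0) b0.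
nra.
Qed.

(** Moving away from a nearby point of [S] along a vector polar to all
    directional normals costs almost no distance to [S].  Maximizing the
    displacement [s'] against a penalty on the squared distance finds the
    obstruction if there is one: the minimizer can stop short of [s] only at a
    nonzero residual, and this residual is a regular normal with which [z] makes
    a definitely acute angle. *)
Lemma polar_shift n (S : set 'rV[R]_n) a w z :
  closed S -> (forall l, dir_normal S a w l -> dot l z <= 0) ->
  forall eta, 0 < eta -> exists2 eps, 0 < eps & forall t s y,
    S y -> dir_near a w eps t y -> 0 <= s -> s <= eps * t ->
    exists2 u, S u & `|y + s *: z - u| <= eta * s.
Proof.
move=> cS zpol eta eta0.
have [|l wl _|eps1 eps10 epsP] :=
    @normals_near R n S a w (fun l => eta / 2 - dot l z).
- move=> l; apply: (@continuousB R R^o _ (cst (eta / 2)) (fun l => dot l z)).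
    exact: cst_continuous.
  apply: (@continuous_dot _ _ _ id (cst z)) => x; first exact: cvg_id.
  exact: cst_continuous.
- by have := zpol _ wl; lra.
have c0 : 0 < 1 + `|z| + eta by rewrite ltr_wpDl// addr_ge0.
have c1 : 1 <= 1 + `|z| + eta.
  by rewrite -addrA lerDl addr_ge0// ltW.
(* The minimizer stays within [s |z| + eta s] of [y]; dividing by the constant
   below keeps it inside the neighborhood where [epsP] applies. *)
exists (eps1 / (1 + `|z| + eta)); first by rewrite divr_gt0.
set eps := eps1 / _ => t s y Sy [t0 teps ynear] s0 seps.
have eps0 : 0 < eps by rewrite divr_gt0.
have epsle : eps <= eps1 by rewrite ler_pdivrMr// ler_peMr// ltW.
have epsE : eps + eps * `|z| + eta * eps = eps1.
  have -> : eps + eps * `|z| + eta * eps = eps * (1 + `|z| + eta) by ring.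
  by rewrite divfK// gt_eqF.
move: s0; rewrite le_eqVlt => /predU1P[<-|s0].
  by exists y => //; rewrite scale0r addr0 subrr normr0 mulr0.
pose res (q : R * 'rV[R]_n) := y + q.1 *: z - q.2.
pose F q := dot (res q) (res q) + eta ^+ 2 * s * (s - q.1).
have cres : continuous res.
  move=> q; apply: (@continuousB R 'rV[R]_n (R * 'rV[R]_n)%type
      (fun q => y + q.1 *: z) snd).
    apply: (@continuousD R 'rV[R]_n (R * 'rV[R]_n)%type (cst y)
        (fun q => q.1 *: z)); first exact: cst_continuous.
    apply: (@continuousZ R 'rV[R]_n (R * 'rV[R]_n)%type fst (cst z)).
      exact: cvg_fst.
    exact: cst_continuous.
  exact: cvg_snd.
have cF : continuous F.
  move=> q; apply: (@continuousD R R^o (R * 'rV[R]_n)%type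
      (fun q => dot (res q) (res q))).
    exact: continuous_dot.
  apply: (@continuousM R (R * 'rV[R]_n)%type (cst (eta ^+ 2 * s)) (fun q => s - q.1)).
    exact: cst_continuous.
  apply: (@continuousB R R^o (R * 'rV[R]_n)%type (cst s) fst).
    exact: cst_continuous.
  exact: cvg_fst.
have F0 : F (0, y) = (eta * s) ^+ 2.
  by rewrite /F /res /= scale0r addr0 subrr dot0l; ring.
have resle s' u : s' <= s -> F (s', u) <= F (0, y) ->
    enorm (res (s', u)) <= eta * s.
  move=> s's; rewrite F0 /F -sqr_enorm /= => h.
  rewrite -(@ler_pXn2r _ 2)// ?nnegrE ?enorm_ge0 ?mulr_ge0 ?(ltW eta0) ?(ltW s0)//.
  rewrite (le_trans _ h)// lerDl mulr_ge0 ?subr_ge0//.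
  by rewrite mulr_ge0 ?sqr_ge0 ?(ltW s0).
have [||s' [u [/= /[!in_itv]/= /andP[s'0 s's] Su umin]]] :=
  @exists_min R R^o n `[0, s]%classic S F 0 y (eta * s + s * `|z|)
    (@segment_compact _ _ _) cS cF _ Sy.
- by rewrite /= in_itv /= lexx (ltW s0).
- move=> s' u /=; rewrite in_itv /= => /andP[s'0 s's] Su Fle.
  have -> : u - y = s' *: z - res (s', u).
    by apply/rowP => i; rewrite ?/r /res !mxE /=; ring.
  rewrite (le_trans (ler_normB _ _))// addrC lerD//.
    by rewrite (le_trans (norm_le_enorm _))// resle.
  by rewrite normrZ ger0_norm// ler_wpM2r.
have Fle : F (s', u) <= F (0, y).
  by apply: umin => //=; rewrite in_itv /= lexx (ltW s0).
have rle := resle _ _ s's Fle.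
move: s's; rewrite le_eqVlt => /predU1P[s'E|s's].
  by exists u => //; rewrite -[s in s *: z]s'E (le_trans (norm_le_enorm _)).
(* From here on, [s' < s] is refuted. *)
exfalso; set r := res (s', u) in rle.
(* Increasing [s'] would lower the penalty at the rate [eta^2 s]. *)
have : eta ^+ 2 * s - dot r z *+ 2 <= 0.
  apply: (@ler_small_step _ (dot z z) (s - s')); rewrite ?subr_gt0 ?dot_ge0//.
  move=> h h0 hs.
  have : F (s', u) <= F (s' + h, u).
    by apply: umin => //=; rewrite in_itv /= addr_ge0 ?(ltW h0)// -lerBrDl.
  have -> : F (s' + h, u) =
      dot (r + h *: z) (r + h *: z) + eta ^+ 2 * s * (s - (s' + h)).
    by rewrite /F /r /res /= scalerDl addrA [_ + h *: z - u]addrAC.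
  rewrite /F -/r dot_sqrD !(dotZr, dotZl) /= => Fh.
  rewrite -(ler_pM2l h0); nra.
move=> rz.
have r0 : r != 0.
  apply: contraTneq rz => ->; rewrite dot0l mul0rn subr0 -ltNge.
  by rewrite mulr_gt0// exprn_gt0.
have unear : dir_near a w eps1 t u.
  split=> //; first exact: lt_le_trans teps epsle.
  have -> : u - a - t *: w = (y - a - t *: w + s' *: z) - r.
    by apply/rowP => i; rewrite ?/r /res !mxE /=; ring.
  rewrite -epsE !mulrDl (le_trans (ler_normB _ _))// lerD//.
    rewrite (le_trans (ler_normD _ _))// lerD// normrZ ger0_norm// mulrAC.
    by rewrite ler_wpM2r// (le_trans (ltW s's)).
  rewrite (le_trans (norm_le_enorm _))// (le_trans rle)// -mulrA.
  by rewrite ler_wpM2l// ltW.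
have umin' u' : S u' -> enorm (y + s' *: z - u) <= enorm (y + s' *: z - u').
  move=> Su'; rewrite -(@ler_pXn2r _ 2)// ?nnegrE ?enorm_ge0// !sqr_enorm.
  have : F (s', u) <= F (s', u') by apply: umin => //=; rewrite in_itv /= s'0 (ltW s's).
  by rewrite /F /res /= lerD2r.
have := epsP _ _ _ unear (nearest_unit_normal Su umin' r0) (dot_normalize r0).
rewrite dotZl -[y + _ - u]/r => h.
have rpos : 0 < enorm r by rewrite enorm_gt0.
have : dot r z < eta / 2 * enorm r.
  by rewrite -ltr_pdivrMr// mulrC; lra.
nra.
Qed.

End PolarShift.

(** * Directional metric subregularity *)

Section Subregularity.
Context {R : realType}.

Lemma mulmx_jacobian n m (g : 'rV[R]_n -> 'rV[R]_m) x v :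
  v *m jacobian g x = 'd g x v.
Proof. by rewrite /jacobian mul_rV_lin1. Qed.

Lemma diff_radius (V W : normedModType R) (g : V -> W) x e :
  differentiable g x -> 0 < e ->
  exists2 r, 0 < r & forall y, `|y - x| < r ->
    `|g y - g x - 'd g x (y - x)| <= e * `|y - x|.
Proof.
move=> dg e0; have /eqaddoP/(_ e e0) := diff_locally dg.
move=> /near_radiusP[r r0 rP]; exists r => // y yx.
have := rP (y - x); rewrite subr0 => /(_ yx).
by rewrite !fctE /= subrK opprD addrA.
Qed.

Lemma continuous_mulmx n m (A : 'M[R]_(n, m)) :
  continuous (fun l : 'rV[R]_n => l *m A).
Proof.
move=> l; have [L L0 LP] := ler_norm_mulmx A.
apply/(@cvgrPdist_le _ _ _ (nbhs l)) => e e0; apply: (near_radiusP l _).2.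
exists (e / L) => [|y]; first by rewrite divr_gt0.
rewrite ltr_pdivlMr// mulrC => /ltW ye.
by rewrite distrC -mulmxBl (le_trans (LP _)).
Qed.

Lemma exists_le_all (s : seq R) :
  (forall c, c \in s -> 0 < c) ->
  exists2 e, 0 < e & forall c, c \in s -> e <= c.
Proof.
elim: s => [|c s IHs] s0; first by exists 1.
have [|e e0 es] := IHs; first by move=> b bs; apply: s0; rewrite inE bs orbT.
exists (Num.min c e); first by rewrite lt_min e0 s0 ?inE ?eqxx.
by move=> b /[!inE] /predU1P[->|/es eb]; rewrite ge_min ?lexx ?eb ?orbT.
Qed.

(** Off the origin the Euclidean norm has the gradient [r / |r|], so that a lower
    bound on the slope of |g y - u| is one on the derivative of [g] tested against
    the residual [r]. *)
Lemma residual_slope n m (g : 'rV[R]_n -> 'rV[R]_m) x u eta v :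
  differentiable g x -> g x - u != 0 -> 0 <= eta ->
  (\forall y \near x, enorm (g x - u) - eta * `|y - x| <= enorm (g y - u)) ->
  - (eta * `|v| * enorm (g x - u)) <= dot (g x - u) ('d g x v).
Proof.
set r := g x - u; set D := 'd g x v => dg r0 eta0 /near_radiusP[e0 e00 slope].
have r_gt0 : 0 < enorm r by rewrite enorm_gt0.
have v1 : 0 < `|v| + 1 by rewrite ltr_wpDl.
rewrite -subr_ge0 -oppr_le0.
apply: (@ler_small_step _ _ (m%:R * (`|r| * `|v|)) 1) => //.
move=> e ep e1; rewrite -subr_le0.
have [d0 d00 gd] := diff_radius dg ep.
have [k k0 kle] : exists2 k, 0 < k & forall c, c \in [:: e0 / (`|v| + 1);
    d0 / (`|v| + 1); enorm r / (eta * (`|v| + 1) + 1)] -> k <= c.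
  apply: exists_le_all => c; rewrite !inE => /or3P[]/eqP->; rewrite divr_gt0//.
  by rewrite ltr_wpDl// mulr_ge0// ltW.
apply: (@ler_small_step _ _ (m%:R * (`|D| + `|v|) ^+ 2) k) => //.
move=> t t0 tk.
have tv_lt c : 0 < c -> k <= c / (`|v| + 1) -> t * `|v| < c.
  move=> c0; rewrite ler_pdivlMr// => kc; apply: lt_le_trans kc.
  rewrite (@lt_le_trans _ _ (t * (`|v| + 1)))// ?ltr_pM2l ?ltrDl//.
  by rewrite ler_wpM2r ?(ltW v1).
have yxE : x + t *: v - x = t *: v by rewrite addrC addKr.
have yx : `|x + t *: v - x| = t * `|v| by rewrite yxE normrZ gtr0_norm.
have te0 : t * `|v| < e0 by apply: tv_lt => //; apply: kle; rewrite !inE eqxx.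
have td0 : t * `|v| < d0 by apply: tv_lt => //; apply: kle; rewrite !inE eqxx ?orbT.
have tr : eta * (t * `|v|) <= enorm r.
  have := kle (enorm r / (eta * (`|v| + 1) + 1)); rewrite !inE eqxx !orbT => /(_ isT).
  rewrite ler_pdivlMr ?ltr_wpDl ?mulr_ge0 ?(ltW v1)// => kr.
  have : t * (eta * (`|v| + 1) + 1) <= k * (eta * (`|v| + 1) + 1).
    by rewrite ler_wpM2r// addr_ge0// mulr_ge0// ltW.
  have : 0 <= t * eta by rewrite mulr_ge0// ltW.
  move: kr t0; lra.
have := slope (x + t *: v); rewrite yx => /(_ te0) sl.
have := gd (x + t *: v); rewrite yx => /(_ td0).
rewrite yxE linearZ -/D; set y := x + t *: v in sl *.
move=> gyD.
(* [o] is the first order remainder of [g]; squaring the hypothesis cancels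
   |r|^2 and leaves [dot r D] as the term of order [t]. *)
pose o := g y - g x - t *: D.
have gyu : g y - u = r + (t *: D + o).
  by apply/rowP => i; rewrite /o /r !mxE; ring.
have sq : (enorm r - eta * (t * `|v|)) ^+ 2 <= dot (g y - u) (g y - u).
  by rewrite -sqr_enorm lerXn2r ?nnegrE ?enorm_ge0// subr_ge0.
move: sq; rewrite gyu sqrrB sqr_enorm dot_sqrD (dotDr (t *: D) o r) dotZr => sq.
have tDo : `|t *: D + o| <= t * (`|D| + `|v|).
  rewrite (le_trans (ler_normD _ _))// mulrDr lerD//; first by rewrite normrZ gtr0_norm.
  rewrite (le_trans gyD)// ler_piMl// mulr_ge0// ltW//.
have b1 : dot (t *: D + o) (t *: D + o) <= m%:R * (t * (`|D| + `|v|)) ^+ 2.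
  rewrite (le_trans (ler_dot _ _))// ler_wpM2l// -expr2 lerXn2r// ?nnegrE//.
  by rewrite (le_trans _ tDo).
have b2 : dot r o <= m%:R * (`|r| * (e * (t * `|v|))).
  by rewrite (le_trans (ler_dot _ _))// ler_wpM2l// ler_wpM2l.
rewrite -(ler_pM2l t0).
have : 0 <= (eta * (t * `|v|)) ^+ 2 by rewrite sqr_ge0.
have : 0 <= m%:R * (t * (`|D| + `|v|)) ^+ 2 by rewrite mulr_ge0 ?sqr_ge0.
move: sq b1 b2; rewrite !exprMn.
lra.
Qed.

(** Metric subregularity of [x |-> g x - S] in the direction [d].  Starting from
    an approximate solution [x], minimizing the residual plus a small multiple of
    the distance to [x] gives either an exact solution close to [x] or a nonzero
    residual; the latter, normalized, is a regular normal on which the adjoint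
    derivative is nearly zero, and [normals_near] excludes this under the
    qualification. *)
Lemma directional_subregularity n m (g : 'rV[R]_n -> 'rV[R]_m)
    (S : set 'rV[R]_m) x0 d :
  closed S -> (forall x, differentiable g x) ->
  (forall v, {for x0, continuous (fun x => 'd g x v)}) ->
  (forall l, dir_normal S (g x0) (d *m jacobian g x0) l ->
    l *m (jacobian g x0)^T = 0 -> l = 0) ->
  exists2 k, 0 < k & exists2 eps, 0 < eps & forall t x y,
    S y -> dir_near x0 d eps t x -> `|g x - y| <= eps * t ->
    exists2 x', S (g x') & `|x' - x| <= k * `|g x - y|.
Proof.
move=> cS dg cdg cq; set J := jacobian g x0 in cq *.
have [|l wl l1|eps1 eps10 epsP] :=
    @normals_near R m S (g x0) (d *m J) (fun l => `|l *m J^T|).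
- move=> l; apply: continuous_comp; first exact: (@continuous_mulmx _ _ J^T).
  exact: norm_continuous.
- rewrite normr_gt0; apply: contra_eq_neq l1 => lJ.
  by rewrite (cq _ wl lJ) dot0l eq_sym oner_eq0.
have [L L0 LP] := ler_norm_mulmx J.
pose eta := eps1 / 4.
have eta0 : 0 < eta by rewrite divr_gt0.
have m1 : 0 < 1 + m%:R :> R by rewrite ltr_pwDl.
have [r1 r10 r1P] : exists2 r, 0 < r & forall x, `|x - x0| < r ->
    forall i : 'I_n,
      `|'d g x (delta_mx 0 i) - 'd g x0 (delta_mx 0 i)| <= eta / (1 + m%:R).
  apply: (near_radiusP x0 _).1.
  apply: (@filter_forall 'rV[R]_n 'I_n
    (fun i x => `|'d g x (delta_mx 0 i) - 'd g x0 (delta_mx 0 i)|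
      <= eta / (1 + m%:R)) (nbhs x0)) => i.
  have /cvgrPdist_le/(_ (eta / (1 + m%:R))) := cdg (delta_mx 0 i).
  rewrite divr_gt0// => /(_ isT); apply: filterS => x /= h.
  by rewrite distrC; exact: h.
have d1 : 0 < `|d| + 1 by rewrite ltr_wpDl.
have [|r2 r20 r2P] := @diff_radius _ _ g x0 (eps1 / (`|d| + 1) / 4) (dg x0).
  by rewrite !divr_gt0.
(* [c] is the factor by which passing from [x] to the minimizer may enlarge the
   distance to the ray through [d]. *)
pose c := 1 + (1 + m%:R) / eta.
have c1 : 1 <= c by rewrite lerDl divr_ge0// ltW.
have c0 : 0 < c by exact: lt_le_trans c1.
have [eps eps0 epsle] : exists2 e, 0 < e & forall b, b \in
    [:: eps1; c^-1; eps1 / (c * L) / 4; eps1 / (1 + m%:R) / 4;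
        r1 / (`|d| + 1); r2 / (`|d| + 1)] -> e <= b.
  apply: exists_le_all => b; rewrite !inE.
  by do ?[case/orP]; move=> /eqP-> //; rewrite ?invr_gt0 ?divr_gt0 ?mulr_gt0.
exists ((1 + m%:R) / eta); first by rewrite divr_gt0.
exists eps => // t x y Sy [t0 teps xnear] gxy.
pose rho := enorm (g x - y).
have rho0 : 0 <= rho by exact: enorm_ge0.
have rhole : rho <= (1 + m%:R) * `|g x - y|.
  by rewrite (le_trans (enorm_le_norm _))// mulrDl mul1r lerDr.
have rhot : rho <= (1 + m%:R) * (eps * t).
  by rewrite (le_trans rhole)// ler_wpM2l// ltW.
have [rho_eq0|rho_neq0] := eqVneq rho 0.
  exists x; last by rewrite subrr normr0 mulr_ge0// divr_ge0// ltW.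
  have : ~~ (g x - y != 0) by rewrite -enorm_gt0 -/rho rho_eq0 ltxx.
  by rewrite negbK subr_eq0 => /eqP->.
have rho_gt0 : 0 < rho by rewrite lt0r rho_neq0.
have cg : continuous g by move=> z; exact: differentiable_continuous.
have cid : continuous (@id 'rV[R]_n) by move=> z; exact: cvg_id.
(* Twice the radius [rho / eta] that the minimizer can reach, so that it is an
   interior point of [K] and [residual_slope] applies to it. *)
pose K := [set x' : 'rV[R]_n | `|x' - x| <= rho / eta + rho / eta].
have cK : compact K by exact: compact_ball.
have Kx : K x by rewrite /K /= subrr normr0 addr_ge0// divr_ge0// ltW.
pose F (q : 'rV[R]_n * 'rV[R]_m) := enorm (g q.1 - q.2) + eta * `|q.1 - x|.
have cF : continuous F.
  move=> q; apply: (@continuousD R R^o ('rV[R]_n * 'rV[R]_m)%type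
      (fun q => enorm (g q.1 - q.2)) (fun q => eta * `|q.1 - x|)).
    apply: continuous_enorm => p.
    apply: (@continuousB R 'rV[R]_m ('rV[R]_n * 'rV[R]_m)%type (g \o fst) snd).
      by apply: continuous_comp; [exact: cvg_fst|exact: cg].
    exact: cvg_snd.
  apply: (@continuousM R ('rV[R]_n * 'rV[R]_m)%type (cst eta) (fun q => `|q.1 - x|)).
    exact: cst_continuous.
  apply: (@continuous_comp ('rV[R]_n * 'rV[R]_m)%type 'rV[R]_n R (fun q => q.1 - x)).
    apply: (@continuousB R 'rV[R]_n ('rV[R]_n * 'rV[R]_m)%type fst (cst x)).
      exact: cvg_fst.
    exact: cst_continuous.
  exact: norm_continuous.
have F0 : F (x, y) = rho by rewrite /F /= subrr normr0 mulr0 addr0.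
have [M MP] : exists M, forall x', K x' -> `|g x' - y| <= M.
  have cgy : continuous (fun z => `|g z - y| : R^o).
    move=> z; apply: (@continuous_comp 'rV[R]_n 'rV[R]_m R (fun z => g z - y)).
      apply: (@continuousB R 'rV[R]_m 'rV[R]_n g (cst y)); first exact: cg.
      exact: cst_continuous.
    exact: norm_continuous.
  have [|xmax _ cmax] := @compact_EVT_max _ R _ K _ cK (continuous_subspaceT cgy).
    by exists x.
  by exists `|g xmax - y| => z Kz; apply: cmax; rewrite inE.
have Fres x' u : F (x', u) <= F (x, y) -> enorm (g x' - u) <= rho.
  by rewrite F0; apply: le_trans; rewrite lerDl mulr_ge0// ltW.
have Fdist x' u : F (x', u) <= F (x, y) -> `|x' - x| <= rho / eta.
  rewrite F0 ler_pdivlMr// mulrC; apply: le_trans.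
  by rewrite lerDr enorm_ge0.
have [|x' [u [Kx' Su umin]]] := @exists_min R _ m K S F x y (rho + M) cK cS cF Kx Sy.
  move=> x' u Kx' Su /Fres Fle.
  have -> : u - y = (g x' - y) - (g x' - u).
    by apply/rowP => i; rewrite !mxE; ring.
  rewrite [rho + M]addrC (le_trans (ler_normB _ _))// lerD ?MP//.
  exact: le_trans (norm_le_enorm _) Fle.
have Fle : F (x', u) <= F (x, y) by exact: umin.
have x'x := Fdist _ _ Fle.
have rle := Fres _ _ Fle.
have [r_eq0|r_neq0] := eqVneq (g x' - u) 0.
  exists x'; first by have /eqP := r_eq0; rewrite subr_eq0 => /eqP->.
  by rewrite (le_trans x'x)// mulrAC ler_wpM2r// invr_ge0 ltW.
(* A nonzero residual would give a unit normal [l] with |l J^T| <= 2 eta < eps1. *)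
exfalso.
have x'near : `|x' - x0 - t *: d| <= c * (eps * t).
  have -> : x' - x0 - t *: d = (x - x0 - t *: d) + (x' - x).
    by apply/rowP => i; rewrite !mxE; ring.
  rewrite mulrDl mul1r (le_trans (ler_normD _ _))// lerD// (le_trans x'x)//.
  by rewrite mulrAC ler_wpM2r// invr_ge0 ltW.
have ceps : c * (eps * t) <= t.
  rewrite mulrA ger_pMl// mulrC -ler_pdivlMr// mul1r epsle//.
  by rewrite !inE eqxx ?orbT.
have x'dist : `|x' - x0| <= t * (`|d| + 1).
  rewrite -(subrK (t *: d) (x' - x0)) addrC (le_trans (ler_normD _ _))// mulrDr mulr1.
  by rewrite lerD// ?(le_trans x'near)// normrZ gtr0_norm.
have tlt r : 0 < r -> eps <= r / (`|d| + 1) -> `|x' - x0| < r.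
  move=> r0; rewrite ler_pdivlMr// => er.
  by rewrite (le_lt_trans x'dist)// (lt_le_trans _ er)// ltr_pM2r.
have x'r1 : `|x' - x0| < r1.
  by apply: tlt => //; apply: epsle; rewrite !inE eqxx ?orbT.
have x'r2 : `|x' - x0| < r2.
  by apply: tlt => //; apply: epsle; rewrite !inE eqxx ?orbT.
have unear : dir_near (g x0) (d *m J) eps1 t u.
  split => //; first by apply: lt_le_trans teps _; apply: epsle; rewrite !inE eqxx.
  have -> : u - g x0 - t *: (d *m J) = (g x' - g x0 - 'd g x0 (x' - x0))
      - (g x' - u) + (x' - x0 - t *: d) *m J.
    rewrite -mulmx_jacobian -/J [(x' - x0 - _) *m J]mulmxBl -scalemxAl.
    move: ((x' - x0) *m J) (d *m J) => p q.
    by apply/rowP => i; rewrite !mxE; ring.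
  have h1 := r2P _ x'r2.
  have h2 := le_trans (norm_le_enorm _) (le_trans rle rhot).
  have h3 := le_trans (LP (x' - x0 - t *: d)) (ler_wpM2l (ltW L0) x'near).
  have e3 : L * (c * (eps * t)) <= eps1 / 4 * t.
    rewrite !mulrA ler_pM2r// mulrC -[leRHS](divfK (lt0r_neq0 (mulr_gt0 c0 L0))).
    rewrite [L * c]mulrC ler_pM2r ?mulr_gt0// mulrAC epsle//.
    by rewrite !inE eqxx ?orbT.
  have e2 : (1 + m%:R) * (eps * t) <= eps1 / 4 * t.
    rewrite mulrA ler_pM2r// mulrC -ler_pdivlMr// mulrAC epsle//.
    by rewrite !inE eqxx ?orbT.
  have e1 : eps1 / (`|d| + 1) / 4 * `|x' - x0| <= eps1 / 4 * t.
    rewrite (le_trans (ler_wpM2l _ x'dist)) ?divr_ge0 ?(ltW eps10) ?(ltW d1)//.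
    have -> : eps1 / (`|d| + 1) / 4 * (t * (`|d| + 1)) = eps1 / 4 * t.
      by field; exact: lt0r_neq0.
    by [].
  rewrite (le_trans (ler_normD _ _))//.
  have := ler_normB (g x' - g x0 - 'd g x0 (x' - x0)) (g x' - u).
  have := mulr_gt0 eps10 t0.
  lra.
have umin' u' : S u' -> enorm (g x' - u) <= enorm (g x' - u').
  by move=> Su'; have := umin _ _ Kx' Su'; rewrite /F /= lerD2r.
have := epsP _ _ _ unear (nearest_unit_normal Su umin' r_neq0) (dot_normalize r_neq0).
set l := _ *: (g x' - u).
suff : `|l *m J^T| <= eta + eta.
  move=> h1 h2; have := le_trans h2 h1; rewrite /eta; lra.
apply: ler_row_norm => [|i]; first by rewrite addr_ge0// ltW.
rewrite -dot_delta dotC -dot_mulmx dotC mulmx_jacobian.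
have slope v : - (eta * `|v|) <= dot l ('d g x' v).
  have : - (eta * `|v| * enorm (g x' - u)) <= dot (g x' - u) ('d g x' v).
    apply: residual_slope => //; first exact: ltW.
    apply/near_radiusP; exists (rho / eta); first by rewrite divr_gt0.
    move=> z zx'.
    have Kz : K z.
      rewrite /K /= -(subrK x' z) -addrA (le_trans (ler_normD _ _))// lerD//.
      exact: ltW.
    have := umin _ _ Kz Su; rewrite /F /=.
    have : `|z - x| <= `|z - x'| + `|x' - x|.
      by rewrite (le_trans _ (ler_normD _ _))// addrA subrK.
    move=> /(ler_wpM2l (ltW eta0)); rewrite mulrDr.
    move: (enorm _) (enorm _) (_ * _) (_ * _) (_ * _) => ? ? ? ? ?; clear; lra.
  have rpos : 0 < enorm (g x' - u) by rewrite enorm_gt0.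
  by rewrite dotZl -ler_pdivrMl ?invr_gt0// invrK mulrN mulrC.
have e1 : `|delta_mx 0 i : 'rV[R]_n| <= 1.
  apply: ler_row_norm => // j; rewrite mxE; case: (_ && _); rewrite ?normr1 ?normr0//.
have slope1 : `|dot l ('d g x' (delta_mx 0 i))| <= eta.
  rewrite ler_norml; apply/andP; split.
    by apply: le_trans (slope _); rewrite lerN2 ger_pMr.
  have := slope (- delta_mx 0 i); rewrite linearN dotNr normrN lerN2 => h.
  by apply: le_trans h _; rewrite ger_pMr.
have -> : dot l ('d g x0 (delta_mx 0 i)) = dot l ('d g x' (delta_mx 0 i))
    - dot l ('d g x' (delta_mx 0 i) - 'd g x0 (delta_mx 0 i)).
  by rewrite dotBr opprB addrC subrK.
rewrite (le_trans (ler_normB _ _))// lerD// (le_trans (ler_norm_dot _ _))//.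
have l1 : `|l| <= 1 by apply/unit_norm_le1/dot_normalize.
have := r1P _ x'r1 i; rewrite ler_pdivlMr// => h.
rewrite (le_trans _ h)// mulrC ler_pM ?mulr_ge0//; first by rewrite ler_piMl.
by rewrite lerDr.
Qed.

End Subregularity.

(** * Second order expansions *)

Section SecondOrderExpansion.
Context {R : realType}.

Lemma dot_grad n (h : 'rV[R]_n -> R) x v :
  differentiable h x -> dot (grad h x) v = 'd h x v.
Proof.
move=> dh; rewrite [in RHS](row_sum_delta v) linear_sum /dot.
by apply: eq_bigr => i _; rewrite mxE deriveE// linearZ mulrC.
Qed.

Lemma differentiable_grad n (h : 'rV[R]_n -> R) x :
  (forall y, differentiable h y) ->
  (forall v, differentiable (fun y => 'd h y v) x) ->
  differentiable (grad h) x.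
Proof.
move=> dh ddh.
have -> : grad h = \sum_i (fun y => 'd h y (delta_mx 0 i) *: delta_mx 0 i).
  apply/funext => y; rewrite fct_sumE [LHS]row_sum_delta.
  by apply: eq_bigr => i _; rewrite mxE deriveE.
by apply: differentiable_sum => i; exact: differentiableZl.
Qed.

Lemma mulmx_hess n (h : 'rV[R]_n -> R) x v :
  v *m hess h x = 'd (grad h) x v.
Proof. exact: mulmx_jacobian. Qed.

Lemma is_derive_line n (h : 'rV[R]_n -> R) x y (s : R) :
  differentiable h (x + s *: y) ->
  is_derive s 1 (fun s : R => h (x + s *: y)) (dot (grad h (x + s *: y)) y).
Proof.
move=> dh.
have dl : is_diff s (cst x + ( *:%R^~ y)) (0 + ( *:%R^~ y)) by exact: is_diffD.
have dhl : differentiable (h \o (cst x + ( *:%R^~ y))) s.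
  by apply: differentiable_comp => //; case: dl.
split; first exact: diff_derivable.
by rewrite deriveE// diff_comp//= diff_val /= !fctE add0r scale1r dot_grad.
Qed.

(** The mean value theorem is applied to the difference between [h] and its
    quadratic model along the segment: the derivative of this difference is the
    first order remainder of the gradient at [x]. *)
Lemma taylor2 n (h : 'rV[R]_n -> R) x e :
  (forall y, differentiable h y) -> differentiable (grad h) x -> 0 < e ->
  exists2 r, 0 < r & forall y, `|y| < r ->
    `|h (x + y) - h x - dot (grad h x) y - 2^-1 * dot (y *m hess h x) y|
      <= e * `|y| ^+ 2.
Proof.
move=> dh dgh e0.
have n0 : 0 < 1 + n%:R :> R by rewrite ltr_pwDl.
have [r r0 rP] := diff_radius dgh (divr_gt0 e0 n0).
exists r => // y yr.
pose a := dot (grad h x) y; pose b := dot (y *m hess h x) y.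
pose psi (s : R) := h (x + s *: y) - (s * a + s ^+ 2 * (2^-1 * b)).
have dpsi (s : R) : is_derive s 1 psi
    (dot (grad h (x + s *: y) - grad h x - (s *: y) *m hess h x) y).
  have := is_derive_line (dh (x + s *: y)) => dline.
  have dq : is_derive s 1 (fun s : R => s * a + s ^+ 2 * (2^-1 * b)) (a + s * b).
    have := @is_deriveD _ _ _ _ _ s 1 _ _
      (is_deriveM (is_derive_id s 1) (is_derive_cst a s 1))
      (is_deriveM (is_deriveX 2 (is_derive_id s 1)) (is_derive_cst (2^-1 * b) s 1)).
    move=> H; apply: (@is_derive_eq _ _ _ _ _ _ _ _ H).
    by rewrite /GRing.scale /= !fctE; field.
  rewrite /psi.
  have -> : dot (grad h (x + s *: y) - grad h x - s *: y *m hess h x) y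
      = dot (grad h (x + s *: y)) y - (a + s * b).
    by rewrite !dotBl -scalemxAl dotZl opprD addrA.
  exact: is_deriveB.
have cpsi : {within `[0, 1], continuous psi}.
  apply: continuous_subspaceT => s; apply/differentiable_continuous.
  by apply/derivable1_diffP; case: (dpsi s).
have [s /[!in_itv]/= /andP[s0 s1] ] := MVT ltr01 (fun s _ => dpsi s) cpsi.
rewrite /psi !scale1r scale0r addr0 !mul0r expr0n/= !mul0r addr0 subr0 expr1n !mul1r.
rewrite subr0 mulr1 => E.
have -> : h (x + y) - h x - dot (grad h x) y - 2^-1 * dot (y *m hess h x) y
   = h (x + y) - (a + 2^-1 * b) - h x by rewrite /a /b; ring.
rewrite E (le_trans (ler_norm_dot _ _))//.
have sy : `|s *: y| <= `|y| by rewrite normrZ gtr0_norm// ler_piMl// ltW.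
have := rP (x + s *: y); rewrite [x + _ - x]addrC addKr => /(_ (le_lt_trans sy yr)).
rewrite -mulmx_hess => h1.
have h2 := le_trans h1 (ler_wpM2l (ltW (divr_gt0 e0 n0)) sy).
rewrite (@le_trans _ _ (n%:R * (e / (1 + n%:R) * `|y| * `|y|)))//.
  by rewrite ler_wpM2l// ler_wpM2r.
rewrite expr2 !mulrA ler_wpM2r// ler_wpM2r// -mulrA mulrCA ler_piMr ?(ltW e0)//.
by rewrite ler_pdivrMr// mul1r lerDr.
Qed.

(** Along the parabolas [x + t d + t^2/2 v] on which second order tangents live,
    uniformly for bounded [v]. *)
Lemma second_order_expansion n (h : 'rV[R]_n -> R) x d M e :
  (forall y, differentiable h y) -> differentiable (grad h) x ->
  0 <= M -> 0 < e ->
  exists2 r, 0 < r & forall t v, 0 < t -> t < r -> `|v| <= M ->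
    `|h (x + t *: d + (2^-1 * t ^+ 2) *: v) - h x - t * dot (grad h x) d
      - 2^-1 * t ^+ 2 * (dot (grad h x) v + dot (d *m hess h x) d)| <= e * t ^+ 2.
Proof.
move=> dh dgh M0 e0.
have [L L0 LP] := ler_norm_mulmx (hess h x).
pose D := `|d| + M + 1.
have D0 : 0 < D by rewrite ltr_wpDl// addr_ge0.
have [r r0 rP] := taylor2 dh dgh (divr_gt0 (divr_gt0 e0 (exprn_gt0 2 D0)) (ltr0Sn _ 1)).
pose B := n%:R * (L * D * D).
have B0 : 0 <= B by rewrite !mulr_ge0 // ltW.
have HB u v : `|u| <= D -> `|v| <= D -> `|dot (u *m hess h x) v| <= B.
  move=> uD vD; rewrite (le_trans (ler_norm_dot _ _))// ler_wpM2l//.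
  by rewrite ler_pM// (le_trans (LP _))// ler_wpM2l// ltW.
have [k k0 kle] : exists2 k, 0 < k &
    forall b, b \in [:: 1; r / D; e / (B + 1) / 2] -> k <= b.
  apply: exists_le_all => b; rewrite !inE => /or3P[]/eqP-> //; rewrite ?divr_gt0//.
  by rewrite ltr_wpDl.
exists k => // t v t0 tk vM.
have t1 : t <= 1 by rewrite (le_trans (ltW tk))// kle ?inE ?eqxx.
have tr : t * D < r.
  by rewrite -ltr_pdivlMr// (lt_le_trans tk)// kle// !inE eqxx ?orbT.
have tB : t * B <= e / 2.
  have : t * (B + 1) <= e / 2.
    rewrite -ler_pdivlMr ?ltr_wpDl// mulrAC (le_trans (ltW tk))// kle//.
    by rewrite !inE eqxx ?orbT.
  by apply: le_trans; rewrite mulrDr mulr1 lerDl ltW.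
have vD : `|v| <= D by rewrite (le_trans vM)// /D addrAC lerDr addr_ge0.
have dD : `|d| <= D by rewrite /D -addrA lerDl addr_ge0.
pose w := d + (2^-1 * t) *: v.
have wD : `|w| <= D.
  rewrite /D (le_trans (ler_normD _ _))// -addrA lerD// normrZ gtr0_norm ?mulr_gt0//.
  rewrite (le_trans _ (_ : M <= M + 1)) ?lerDl// (le_trans _ vM)// ler_piMl//.
  by rewrite mulr_ile1 // ?invr_ge0 ?(ltW t0)// invf_le1 // ler1n.
have -> : x + t *: d + (2^-1 * t ^+ 2) *: v = x + t *: w.
  by apply/rowP => i; rewrite !mxE; ring.
have tw : `|t *: w| <= t * D by rewrite normrZ gtr0_norm// ler_wpM2l// ltW.
have := rP (t *: w) (le_lt_trans tw tr).
have -> : dot (grad h x) (t *: w) = t * dot (grad h x) d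
    + 2^-1 * t ^+ 2 * dot (grad h x) v.
  by rewrite /w dotZr dotDr dotZr; ring.
(* The Hessian at [t w] differs from its value at [t d] by terms of order t^3. *)
have -> : 2^-1 * dot (t *: w *m hess h x) (t *: w) =
    2^-1 * t ^+ 2 * dot (d *m hess h x) d + 4^-1 * t ^+ 3 *
    (dot (v *m hess h x) d + dot (w *m hess h x) v).
  rewrite -scalemxAl dotZl dotZr /w !mulmxDl -!scalemxAl.
  by rewrite !(dotDl, dotDr, dotZl, dotZr); field.
have := HB v d vD dD; have := HB w v wD vD.
move: (dot (v *m _) d) (dot (w *m _) v) => p q qB pB.
have : `|t *: w| ^+ 2 <= (t * D) ^+ 2.
  by rewrite lerXn2r ?nnegrE ?mulr_ge0 ?(ltW t0) ?(ltW D0).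
move=> /(ler_wpM2l (ltW (divr_gt0 (divr_gt0 e0 (exprn_gt0 2 D0)) (ltr0Sn _ 1)))).
have -> : e / D ^+ 2 / 2 * (t * D) ^+ 2 = e / 2 * t ^+ 2.
  by field; exact: lt0r_neq0.
move=> h1 h2; have {h1 h2} h3 := le_trans h2 h1.
have h4 : `|4^-1 * t ^+ 3 * (p + q)| <= e / 2 * t ^+ 2.
  rewrite normrM ger0_norm ?mulr_ge0 ?exprn_ge0 ?(ltW t0) ?invr_ge0//.
  rewrite (@le_trans _ _ (4^-1 * t ^+ 3 * (B + B)))//.
    rewrite ler_wpM2l ?mulr_ge0 ?exprn_ge0 ?(ltW t0) ?invr_ge0//.
    by rewrite (le_trans (ler_normD _ _))// lerD.
  rewrite (_ : _ * (B + B) = t * B / 2 * t ^+ 2); last by field.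
  rewrite ler_wpM2r ?sqr_ge0//.
  have : 0 <= t * B by rewrite mulr_ge0// ltW.
  by move: tB; move: (t * B) => s; clear; lra.
move: h3 h4.
set X := h (x + t *: w); set G := dot (grad h x) d; set V := dot (grad h x) v.
set Q := dot (d *m hess h x) d => h3 h4.
have -> : X - h x - t * G - 2^-1 * t ^+ 2 * (V + Q) =
  (X - h x - (t * G + 2^-1 * t ^+ 2 * V)
   - (2^-1 * t ^+ 2 * Q + 4^-1 * t ^+ 3 * (p + q))) + 4^-1 * t ^+ 3 * (p + q).
  by ring.
rewrite (le_trans (ler_normD _ _))// (le_trans (lerD h3 h4))//.
by rewrite -mulrDl -splitr.
Qed.

Lemma diff_coord n m (g : 'rV[R]_n -> 'rV[R]_m) x i :
  differentiable g x ->
  is_diff x (fun y => g y ord0 i) (fun v => 'd g x v ord0 i).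
Proof.
move=> dg.
have dc y : is_diff y (fun M : 'rV[R]_m => M ord0 i) (fun M : 'rV[R]_m => M ord0 i).
  have clin : linear (fun M : 'rV[R]_m => M ord0 i : R^o) by move=> a u v; rewrite !mxE.
  pose clinM := GRing.isLinear.Build _ _ _ _ _ clin.
  pose c : {linear 'rV[R]_m -> R^o} :=
    HB.pack (fun M : 'rV[R]_m => M ord0 i : R^o) clinM.
  have cc : continuous c by exact: coord_continuous.
  split; first exact: (linear_differentiable y cc).
  exact: (diff_lin y cc).
exact: (@is_diff_comp _ _ _ _ _ _ _ _ x (differentiableP dg) (dc (g x))).
Qed.

(** The second derivative [g''(x)(d, d)] of a vector-valued map. *)
Definition hess_quad n m (g : 'rV[R]_n -> 'rV[R]_m) x d : 'rV[R]_m :=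
  \row_i dot (d *m hess (fun y => g y ord0 i) x) d.

Lemma twice_cont_diff_coord n m (g : 'rV[R]_n -> 'rV[R]_m) i x :
  twice_cont_diff g -> (forall y, differentiable (fun y => g y ord0 i) y) /\
    differentiable (grad (fun y => g y ord0 i)) x.
Proof.
case=> dg ddg _.
have dgi y : differentiable (fun y => g y ord0 i) y by case: (diff_coord i (dg y)).
split => //; apply: differentiable_grad => // v.
have -> : (fun y => 'd (fun y => g y ord0 i) y v) = (fun y => 'd g y v ord0 i).
  by apply/funext => y; have [_ ->] := diff_coord i (dg y).
by case: (@diff_coord _ _ (fun y => 'd g y v) x i (ddg v x)).
Qed.

Lemma second_order_expansion_vec n m (g : 'rV[R]_n -> 'rV[R]_m) x d M e :
  twice_cont_diff g -> 0 <= M -> 0 < e ->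
  exists2 r, 0 < r & forall t v, 0 < t -> t < r -> `|v| <= M ->
    `|g (x + t *: d + (2^-1 * t ^+ 2) *: v) - g x - t *: (d *m jacobian g x)
      - (2^-1 * t ^+ 2) *: (v *m jacobian g x + hess_quad g x d)| <= e * t ^+ 2.
Proof.
move=> g2 M0 e0.
have rex (i : 'I_m) : exists r, 0 < r /\ forall t v, 0 < t -> t < r -> `|v| <= M ->
    `|(g (x + t *: d + (2^-1 * t ^+ 2) *: v) - g x - t *: (d *m jacobian g x)
      - (2^-1 * t ^+ 2) *: (v *m jacobian g x + hess_quad g x d)) ord0 i| <= e * t ^+ 2.
  have [dgi ddgi] := @twice_cont_diff_coord _ _ g i x g2.
  have [r r0 rP] := second_order_expansion d dgi ddgi M0 e0.
  exists r; split=> // t v t0 tr vM; apply: le_trans (rP t v t0 tr vM).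
  have gradE u : dot (grad (fun y => g y ord0 i) x) u = (u *m jacobian g x) ord0 i.
    rewrite dot_grad// mulmx_jacobian; case: g2 => dg _ _.
    by have [_ ->] := diff_coord i (dg x).
  by rewrite !gradE; rewrite !mxE.
have [r rP] := choice rex.
have [r0 r00 r0le] : exists2 r0, 0 < r0 & forall b, b \in codom r -> r0 <= b.
  by apply: exists_le_all => b /codomP[i ->]; case: (rP i).
exists r0 => // t v t0 tr vM; apply: ler_row_norm => [|i].
  by rewrite mulr_ge0 ?sqr_ge0 ?(ltW e0).
have [_] := rP i; apply => //; apply: lt_le_trans tr _.
by apply: r0le; exact: codom_f.
Qed.

End SecondOrderExpansion.

(** * The primal second order condition *)

Section PrimalCondition.
Context {R : realType}.

(** The second order necessary condition in primal form.  The feasible parabola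
    through [w] is moved first, by [polar_shift], to one whose second order part
    is [w + z], the value which [g] takes along the parabola with acceleration
    [v]; then [directional_subregularity] corrects the latter into a feasible
    one.  Both corrections are o(t^2), so that they do not affect the second
    order expansion of [f]. *)
Lemma primal_second_order n m (f : 'rV[R]_n -> R) (g : 'rV[R]_n -> 'rV[R]_m)
    (S : set 'rV[R]_m) x0 d v w :
  twice_cont_diff f -> twice_cont_diff g -> closed S -> local_optimal f g S x0 ->
  dot (grad f x0) d <= 0 ->
  (forall l, dir_normal S (g x0) (d *m jacobian g x0) l ->
    l *m (jacobian g x0)^T = 0 -> l = 0) ->
  tangent_set2 S (g x0) (d *m jacobian g x0) w ->
  (forall l, dir_normal S (g x0) (d *m jacobian g x0) l ->
    dot l (v *m jacobian g x0 + hess_quad g x0 d - w) <= 0) ->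
  0 <= dot (grad f x0) v + dot (d *m hess f x0) d.
Proof.
set J := jacobian g x0; set q := hess_quad g x0 d; set z := v *m J + q - w.
set c := grad f x0; set alpha := dot (d *m hess f x0) d.
move=> f2 g2 cS [Sg0 fopt] cd cq [tk [wk [[tk0 tkcvg] wkcvg Sk]]] zpol.
have [df ddf _] := f2; have [dg ddg _] := g2.
have dgf := differentiable_grad df (fun v => ddf v x0).
have [|k k0 [eps3 eps30 subreg]] := directional_subregularity cS dg _ cq.
  by move=> u; apply: differentiable_continuous; exact: ddg.
(* The corrected acceleration [v'] below satisfies |v' - v| <= 4 k eta. *)
rewrite -oppr_le0; pose M := `|v| + 4 * k.
have M0 : 0 <= M by rewrite addr_ge0// mulr_ge0// ltW.
apply: (@ler_small_step _ _ (2 + n%:R * (`|c| * (4 * k))) 1) => //.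
  by rewrite addr_ge0// !mulr_ge0// ltW.
(* The inequality is proved up to a multiple of an arbitrary [eta]. *)
move=> eta eta0 eta1.
have [eps2 eps20 shift] := polar_shift cS zpol eta0.
have [rf rf0 fexp] := second_order_expansion d df dgf M0 eta0.
have [rg rg0 gexp] := second_order_expansion_vec x0 d g2 (normr_ge0 v) eta0.
have [ro ro0 opt] := (near_radiusP x0 _).1 fopt.
have W0 : 0 < `|w| + 1 by rewrite ltr_wpDl.
have V0 : 0 < `|v| + 1 by rewrite ltr_wpDl.
have D0 : 0 < `|d| + M + 1 by rewrite ltr_wpDl// addr_ge0.
have [e e0 ele] : exists2 e, 0 < e & forall b, b \in [:: rf; rg; eps2; eps3;
    eps2 / (`|w| + 1); eps3 / 2; eps3 / (`|v| + 1); ro / (`|d| + M + 1); 1] -> e <= b.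
  apply: exists_le_all => b; rewrite !inE.
  by do ?[case/orP]; move=> /eqP->; rewrite ?divr_gt0.
have [j [tj wj]] : exists j, tk j < e /\ `|wk j - w| <= eta.
  have wnear : \forall j \near \oo, `|w - wk j| <= eta.
    by move/cvgrPdist_le: wkcvg; apply.
  have tnear : \forall j \near \oo, `|0 - tk j| <= e / 2.
    by move/cvgrPdist_le: tkcvg; apply; rewrite divr_gt0.
  near \oo => j; exists j; split.
    have : `|0 - tk j| <= e / 2 by near: j.
    rewrite sub0r normrN gtr0_norm// => h; rewrite (le_lt_trans h)//.
    by rewrite ltr_pdivrMr// ltr_pMr// ltr1n.
  by rewrite distrC; near: j.
have := Sk j; have := tk0 j; move: (tk j) (wk j) tj wj => t wt te wtw t0 Sy {Sk tk0}.
have tle b : b \in [:: rf; rg; eps2; eps3;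
    eps2 / (`|w| + 1); eps3 / 2; eps3 / (`|v| + 1); ro / (`|d| + M + 1); 1] -> t < b.
  by move=> /ele; exact: lt_le_trans.
have t1 : t <= 1 by rewrite ltW// tle// !inE eqxx ?orbT.
pose s := 2^-1 * t ^+ 2.
have s0 : 0 < s by rewrite mulr_gt0// exprn_gt0.
have s2 : t ^+ 2 = s + s by rewrite /s; field.
have st : s <= t * t by rewrite /s -expr2 ger_pMl ?exprn_gt0// invf_le1// ler1n.
rewrite -/s in Sy.
pose y := g x0 + t *: (d *m J) + s *: wt.
have ynear : dir_near (g x0) (d *m J) eps2 t y.
  split=> //; first by apply: tle; rewrite !inE eqxx ?orbT.
  have -> : y - g x0 - t *: (d *m J) = s *: wt by apply/rowP => i; rewrite !mxE; ring.
  rewrite normrZ gtr0_norm//.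
  have wtle : `|wt| <= `|w| + 1.
    rewrite -(subrK w wt) addrC (le_trans (ler_normD _ _))// lerD//.
    exact: le_trans eta1.
  rewrite (le_trans (ler_pM (ltW s0) (normr_ge0 _) st wtle))// mulrC mulrA.
  rewrite ler_pM2r// mulrC -ler_pdivlMr// ltW// tle//.
  by rewrite !inE eqxx ?orbT.
have [|u Su yzu] := shift t s y Sy ynear (ltW s0).
  by rewrite (le_trans st)// ler_pM2r// ltW// tle// !inE eqxx ?orbT.
pose x := x0 + t *: d + s *: v.
have xnear : dir_near x0 d eps3 t x.
  split=> //; first by apply: tle; rewrite !inE eqxx ?orbT.
  have -> : x - x0 - t *: d = s *: v by apply/rowP => i; rewrite !mxE; ring.
  rewrite normrZ gtr0_norm//.
  have vle : `|v| <= `|v| + 1 by rewrite lerDl.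
  rewrite (le_trans (ler_pM (ltW s0) (normr_ge0 _) st vle))// mulrC mulrA.
  rewrite ler_pM2r// mulrC -ler_pdivlMr// ltW// tle//.
  by rewrite !inE eqxx ?orbT.
have gxu : `|g x - u| <= 2 * eta * t ^+ 2.
  have := gexp t v t0; rewrite lexx => /(_ (tle _ _) isT).
  rewrite !inE eqxx ?orbT => /(_ isT); rewrite -/s -/J -/q -/x => h1.
  have -> : g x - u = (g x - g x0 - t *: (d *m J) - s *: (v *m J + q))
     + (y + s *: z - u) - s *: (wt - w).
    rewrite /y /z; move: (g x) (v *m J) (d *m J) => a1 a2 a3.
    by apply/rowP => i; rewrite !mxE; ring.
  rewrite (le_trans (ler_normB _ _))//.
  have h2 : `|s *: (wt - w)| <= s * eta by rewrite normrZ gtr0_norm// ler_pM2l.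
  have h3 := ler_normD (g x - g x0 - t *: (d *m J) - s *: (v *m J + q))
    (y + s *: z - u).
  have h5 := lerD (le_trans h3 (lerD h1 yzu)) h2.
  rewrite (le_trans h5)// s2 le_eqVlt; apply/orP; left; apply/eqP; ring.
have [|x' Sx' xx'] := subreg t x u Su xnear.
  rewrite (le_trans gxu)// expr2 mulrA ler_pM2r//.
  rewrite (@le_trans _ _ (2 * t))// ?ler_pM2r ?ler_piMr//.
  by rewrite mulrC -ler_pdivlMr// ltW// tle// !inE eqxx ?orbT.
pose v' := s^-1 *: (x' - x0 - t *: d).
have x'E : x' = x0 + t *: d + s *: v'.
  by rewrite /v' scalerA mulfV ?lt0r_neq0// scale1r addrACA subrr addr0 addrC subrK.
have v'v : `|v' - v| <= 4 * k * eta.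
  have -> : v' - v = s^-1 *: (x' - x).
    rewrite {1}x'E /x.
    have -> : x0 + t *: d + s *: v' - (x0 + t *: d + s *: v) = s *: (v' - v).
      by apply/rowP => i; rewrite !mxE; ring.
    by rewrite scalerA mulVf ?lt0r_neq0// scale1r.
  rewrite normrZ gtr0_norm ?invr_gt0// mulrC ler_pdivrMr//.
  rewrite (le_trans xx')// (le_trans (ler_wpM2l (ltW k0) gxu))// s2.
  by rewrite le_eqVlt; apply/orP; left; apply/eqP; ring.
have v'M : `|v'| <= M.
  rewrite -(subrK v v') addrC (le_trans (ler_normD _ _))// lerD//.
  by rewrite (le_trans v'v)// ger_pMr// mulr_gt0.
have x'ro : `|x' - x0| < ro.
  have -> : x' - x0 = t *: d + s *: v' by rewrite {1}x'E [LHS]addrC !addrA addNr add0r.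
  rewrite (le_lt_trans (ler_normD _ _))// (normrZ t) (normrZ s).
  rewrite (gtr0_norm t0) (gtr0_norm s0).
  apply: (@le_lt_trans _ _ (t * (`|d| + M + 1))); last first.
    by rewrite -ltr_pdivlMr// tle// !inE eqxx ?orbT.
  have -> : t * (`|d| + M + 1) = t * `|d| + (t * M + t) by ring.
  apply: lerD => //; apply: (@le_trans _ _ (t * M)); last by rewrite lerDl ltW.
  by apply: ler_pM => //; [exact: ltW|rewrite (le_trans st)// ler_piMr// ltW].
have fle : f x0 <= f x' by apply: opt.
have := fexp t v' t0; rewrite v'M => /(_ (tle _ _) isT).
rewrite !inE eqxx ?orbT => /(_ isT); rewrite -/s -x'E -/c -/alpha => fx'.
have tcd : t * dot c d <= 0 by rewrite mulr_ge0_le0// ltW.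
have h1 : 0 <= s * (dot c v' + alpha) + eta * t ^+ 2.
  move: fx'; rewrite ler_norml => /andP[_]; move: tcd fle.
  by move: (t * dot c d) (s * _) (eta * _) (f x0) (f x') => ? ? ? ? ?; clear; lra.
have h2 : 0 <= dot c v' + alpha + 2 * eta.
  rewrite -(pmulr_rge0 _ s0); move: h1; rewrite s2.
  by congr (_ <= _); ring.
have h3 : dot c (v' - v) <= n%:R * (`|c| * (4 * k)) * eta.
  by rewrite (le_trans (ler_dot _ _))// -mulrA ler_wpM2l// -mulrA ler_wpM2l.
move: h2 h3; rewrite dotBr.
move: (dot c v') (dot c v) (n%:R * _) => ? ? ?; clear; lra.
Unshelve. all: by end_near. Qed.

End PrimalCondition.

(** * Separation, bipolarity and multipliers *)

Section ConvexDuality.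
Context {R : realType}.

Lemma convex_setP n (A : set 'rV[R]_n) :
  @convex_set R 'rV[R]_n A <->
  forall x y t, A x -> A y -> 0 <= t <= 1 -> A (t *: x + (1 - t) *: y).
Proof.
split=> [cA x y t Ax Ay t01|cA x y t /[!inE] Ax Ay].
  have := cA x y (Itv01 (andP t01).1 (andP t01).2).
  by rewrite !inE; apply.
by apply: cA => //; rewrite ge0 le1.
Qed.

(** Variational inequality for a point of least norm, in the direction [- h]. *)
Lemma min_norm_segment n (r h : 'rV[R]_n) :
  (forall t, 0 < t -> t <= 1 -> dot r r <= dot (r - t *: h) (r - t *: h)) ->
  dot r h <= 0.
Proof.
move=> rmin; rewrite -(@pmulrn_lle0 _ _ 2)//.
apply: (@ler_small_step _ _ (dot h h) 1) => //; first exact: dot_ge0.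
move=> t t0 t1; have := rmin t t0 t1.
rewrite (dot_sqrB r) !(dotZl, dotZr) => rt.
by rewrite -(ler_pM2l t0); lra.
Qed.

Lemma convex_weighted_sum n (E : set 'rV[R]_n) k (a : 'I_k -> R)
    (e : 'I_k -> 'rV[R]_n) :
  (forall x y t, E x -> E y -> 0 <= t <= 1 -> E (t *: x + (1 - t) *: y)) ->
  (forall i, 0 <= a i) -> (forall i, E (e i)) -> \sum_i a i = 1 ->
  E (\sum_i a i *: e i).
Proof.
move=> cE a0 Ee a1.
(* [K s x]: [x] lies in [s E], and is zero when [s] is zero; this is preserved
   by adding weights and vectors simultaneously. *)
pose K (s : R) (x : 'rV[R]_n) := (s = 0 /\ x = 0) \/ (0 < s /\ E (s^-1 *: x)).
suff : K (\sum_i a i) (\sum_i a i *: e i).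
  case=> [[s0 _]|[_]]; last by rewrite a1 invr1 scale1r.
  by move: a1; rewrite s0 => /eqP; rewrite eq_sym oner_eq0.
apply: (big_ind2 K) => [|s x t y [[-> ->]|[s0 Ex]] [[-> ->]|[t0 Ey]]|i _].
- by left.
- by left; rewrite !addr0.
- by right; rewrite !add0r.
- by right; rewrite !addr0.
- right; split; first exact: addr_gt0.
  have st0 : s + t != 0 by rewrite gt_eqF// addr_gt0.
  have := cE _ _ (s / (s + t)) Ex Ey.
  rewrite divr_ge0 ?addr_ge0 ?(ltW s0) ?(ltW t0)//= ler_pdivrMr ?addr_gt0//.
  rewrite mul1r lerDl (ltW t0).
  move=> /(_ isT); congr E; rewrite !scalerA scalerDr; congr (_ *: _ + _ *: _).
    by field; rewrite st0 lt0r_neq0.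
  by field; rewrite st0 lt0r_neq0.
- have := a0 i; rewrite le_eqVlt => /predU1P[<-|ai0]; first by left; rewrite scale0r.
  by right; split=> //; rewrite scalerA mulVf ?scale1r// gt_eqF.
Qed.

Lemma finite_separation n (E : set 'rV[R]_n) (s : seq 'rV[R]_n) :
  (forall x y t, E x -> E y -> 0 <= t <= 1 -> E (t *: x + (1 - t) *: y)) ->
  ~ E 0 -> s != [::] -> (forall e, e \in s -> E e) ->
  exists2 xi, dot xi xi = 1 & forall e, e \in s -> 0 <= dot xi e.
Proof.
move=> cE E0 s0 Es; pose k := size s.
pose A : 'M[R]_(k, n) := \matrix_i s`_i.
have AE (a : 'rV[R]_k) : a *m A = \sum_i a ord0 i *: s`_i.
  by rewrite mulmx_sum_row; apply: eq_bigr => i _; rewrite rowK.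
pose Q := [set a : 'rV[R]_k | (forall i, 0 <= a ord0 i) /\ \sum_i a ord0 i = 1].
have cQ : compact Q.
  have ci i : continuous (fun a : 'rV[R]_k => a ord0 i) by exact: coord_continuous.
  have csum : continuous (fun a : 'rV[R]_k => \sum_i a ord0 i).
    by apply: continuous_big => [|i _]; [exact: add_continuous|exact: ci].
  apply: (subclosed_compact _ (@compact_ball _ _ (0 : 'rV[R]_k) 1)).
    have -> : Q = (\bigcap_(i in [set: 'I_k]) [set a | - a ord0 i <= 0]) `&`
        ([set a | \sum_i a ord0 i <= 1] `&` [set a | - \sum_i a ord0 i <= - 1]).
      apply/seteqP; split=> a /=.
        by case=> a0 ->; split=> // i _ /=; rewrite oppr_le0.
      case=> a0 [h1]; rewrite lerN2 => h2; split.
        by move=> i; rewrite -oppr_le0; exact: a0.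
      by apply/eqP; rewrite eq_le h1.
    apply: closedI; first apply: closed_bigI => i _.
      by apply: closed_sublevel => a; exact: (cvgN (ci i a)).
    apply: closedI; first exact: closed_sublevel.
    by apply: closed_sublevel => a; exact: (cvgN (csum a)).
  move=> a [a0 a1] /=; rewrite subr0; apply: ler_row_norm => // i.
  by rewrite ger0_norm// -a1 (bigD1 i)//= lerDl sumr_ge0.
have Qdelta i : Q (delta_mx ord0 i).
  split=> [j|]; first by rewrite mxE; case: (_ && _).
  rewrite (bigD1 i)//= big1 ?addr0 => [|j ji]; rewrite mxE ?(negbTE ji) ?andbF//.
  by rewrite !eqxx.
have k0 : (0 < k)%N by rewrite lt0n size_eq0.
have cF : continuous (fun a : 'rV[R]_k => dot (a *m A) (a *m A)).
  by apply: continuous_dot; exact: continuous_mulmx.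
have [|a /[!inE] -[a0 a1] amin] := compact_EVT_min _ cQ (continuous_subspaceT cF).
  by exists (delta_mx ord0 (Ordinal k0)).
set p := a *m A in amin.
have Ep : E p.
  by rewrite /p AE; apply: convex_weighted_sum => // i; apply/Es/mem_nth.
have p0 : p != 0 by apply/eqP => pE; apply: E0; rewrite -pE.
have rpos : 0 < (enorm p)^-1 by rewrite invr_gt0 enorm_gt0.
exists ((enorm p)^-1 *: p); first exact: dot_normalize.
move=> e /(nthP 0)[i ik <-]; rewrite dotZl pmulr_rge0//.
pose b : 'rV[R]_k := delta_mx ord0 (Ordinal ik).
have bA : b *m A = s`_i by rewrite -rowE rowK.
have : dot p (p - s`_i) <= 0.
  apply: min_norm_segment => t t0 t1.
  have -> : p - t *: (p - s`_i) = ((1 - t) *: a + t *: b) *m A.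
    rewrite mulmxDl -!scalemxAl -/p bA; apply/rowP => j; rewrite !mxE; ring.
  apply: amin; rewrite inE; split=> [j|].
    by rewrite !mxE addr_ge0// mulr_ge0 ?subr_ge0 ?(ltW t0)//; case: (_ && _).
  under eq_bigr do rewrite !mxE.
  have [_ b1] := Qdelta (Ordinal ik).
  by rewrite big_split/= -!mulr_sumr a1 (eq_bigr (fun j => b ord0 j)) => [|j _];
    rewrite ?mxE// b1; ring.
by rewrite dotBr subr_le0; apply: le_trans; exact: dot_ge0.
Qed.

(** Separation of a point from a convex set that need not be closed: each finite
    part of [E] is strictly separated from the origin by the point of least norm
    of its convex hull, and the unit normals obtained in this way accumulate by
    compactness of the sphere. *)
Lemma convex_separation n (E : set 'rV[R]_n) :
  (forall x y t, E x -> E y -> 0 <= t <= 1 -> E (t *: x + (1 - t) *: y)) ->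
  ~ E 0 -> E !=set0 ->
  exists2 xi, xi != 0 & forall e, E e -> 0 <= dot xi e.
Proof.
move=> cE E0 [e0 Ee0].
have := @compact_unit_sphere R n; rewrite compact_In0 => /= cS.
pose sphere := [set l : 'rV[R]_n | dot l l = 1].
have [||xi xiP] := cS 'rV[R]_n E (fun e => sphere `&` [set xi | - dot xi e <= 0]).
- exists (fun e => [set xi | - dot xi e <= 0]) => // e Ee.
  apply: closed_sublevel => xi.
  have cd : continuous (fun xi => dot xi e).
    apply: (@continuous_dot _ _ _ id (cst e)) => x; first exact: cvg_id.
    exact: cst_continuous.
  exact: (cvgN (cd xi)).
- move=> D' D'E.
  have [//|e|xi xi1 xiD] := @finite_separation n E (e0 :: finmap.enum_fset D') cE E0.
    by rewrite inE => /predU1P[->//|/D'E]; rewrite inE.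
  by exists xi => e eD'; split=> //=; rewrite oppr_le0 xiD// inE eD' orbT.
exists xi; last by move=> e /xiP[_ /=]; rewrite oppr_le0.
apply/eqP => xi0; have [] := xiP _ Ee0.
by rewrite /sphere /= xi0 dot0l => /eqP; rewrite eq_sym oner_eq0.
Qed.

(** The bipolar theorem: the residual of the nearest point of [K] to [l] belongs
    to the polar cone, and testing it against [l] shows that it vanishes. *)
Lemma bipolar n (K : set 'rV[R]_n) l :
  closed K -> K !=set0 ->
  (forall x y t, K x -> K y -> 0 <= t <= 1 -> K (t *: x + (1 - t) *: y)) ->
  (forall x c, 0 < c -> K x -> K (c *: x)) ->
  (forall z, (forall x, K x -> dot x z <= 0) -> dot l z <= 0) -> K l.
Proof.
move=> cK K0 Kconv Kcone lP.
have [p Kp pmin] := @exists_nearest R n K l cK K0.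
pose z := l - p.
have zmin x : K x -> dot z (x - p) <= 0.
  move=> Kx; apply: min_norm_segment => t t0 t1.
  have -> : z - t *: (x - p) = l - (t *: x + (1 - t) *: p).
    by apply/rowP => i; rewrite !mxE; ring.
  rewrite -!sqr_enorm lerXn2r ?nnegrE ?enorm_ge0//; apply: pmin.
  by apply: Kconv => //; rewrite ltW.
(* A cone contains [2 p] and [p / 2], on both sides of [p] on its ray. *)
have zp : dot z p = 0.
  apply/eqP; rewrite eq_le; apply/andP; split.
    have := zmin (2 *: p); rewrite -[X in _ - X]scale1r -scalerBl.
    by rewrite (_ : 2 - 1 = 1 :> R) ?scale1r; [apply; exact: Kcone|ring].
  have := zmin (2^-1 *: p); rewrite -[X in _ - X]scale1r -scalerBl dotZr.
  have half : 0 < 2^-1 :> R by rewrite invr_gt0.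
  by move=> /(_ (Kcone _ _ half Kp)); move: (dot z p) => ?; clear; lra.
have : dot l z <= 0.
  by apply: lP => x /zmin; rewrite dotBr zp subr0 dotC.
rewrite -(subrK p l) -/z dotDl [dot p z]dotC zp addr0 => zz.
have : dot z z == 0 by rewrite eq_le zz dot_ge0.
by rewrite dot_eq0 => /eqP ->; rewrite add0r.
Qed.

Lemma ge0_of_large (a b : R) : (forall c, 0 < c -> 0 <= a + c * b) -> 0 <= b.
Proof.
move=> ab; rewrite -oppr_le0.
apply: (@ler_small_step _ _ `|a| 1) => // h h0 _.
have := ab h^-1; rewrite invr_gt0 => /(_ h0).
rewrite -(pmulr_rge0 _ h0) mulrDr mulVKf ?gt_eqF// => h1.
have := ler_wpM2l (ltW h0) (ler_norm a); lra.
Qed.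

(** Duality for the linear problem of minimizing [c v + alpha] subject to
    [v J + q] in [C] plus the polar of [K]: nonnegativity of its values yields a
    multiplier in [K] common to all [w] in [C].  The qualification makes the
    cost component of the separating vector nonzero. *)
Lemma conic_multiplier n m (J : 'M[R]_(n, m)) (K C : set 'rV[R]_m) q c alpha :
  closed K -> K !=set0 ->
  (forall x y t, K x -> K y -> 0 <= t <= 1 -> K (t *: x + (1 - t) *: y)) ->
  (forall x c, 0 < c -> K x -> K (c *: x)) ->
  (forall l, K l -> l *m J^T = 0 -> l = 0) ->
  C !=set0 ->
  (forall x y t, C x -> C y -> 0 <= t <= 1 -> C (t *: x + (1 - t) *: y)) ->
  (forall v w, C w -> (forall l, K l -> dot l (v *m J + q - w) <= 0) ->
    0 <= dot c v + alpha) ->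
  exists2 l, K l & c + l *m J^T = 0 /\ forall w, C w -> dot l w <= dot l q + alpha.
Proof.
move=> cK K0 Kconv Kcone cq [w0 Cw0] Cconv primal.
pose polar z := forall l, K l -> dot l z <= 0.
have polar0 : polar 0 by move=> l _; rewrite dot0r.
(* The slack [s > 0] keeps the origin out of [E] without affecting the infimum. *)
pose E := [set e : 'rV[R]_(m + 1) | exists v w z s, [/\ C w, polar z, 0 < s &
  e = row_mx (v *m J + q - w - z) (const_mx (dot c v + alpha + s))]].
have [|||xi xi0 xiE] := @convex_separation _ E.
- move=> _ _ t [v [w [z [s [Cw pz s0 ->]]]]] [v' [w' [z' [s' [Cw' pz' s'0 ->]]]]].
  move=> t01; have /andP[t0 t1] := t01.
  exists (t *: v + (1 - t) *: v'), (t *: w + (1 - t) *: w'),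
    (t *: z + (1 - t) *: z'), (t * s + (1 - t) * s'); split.
  + exact: Cconv.
  + move=> l Kl; rewrite dotDr !dotZr.
    by rewrite -(addr0 0) lerD// mulr_ge0_le0 ?subr_ge0 ?pz ?pz'.
  + have [->|tn0] := eqVneq t 0; first by rewrite mul0r add0r subr0 mul1r.
    by rewrite ltr_pwDl ?mulr_gt0 ?mulr_ge0 ?subr_ge0 ?(ltW s'0)// lt0r tn0.
  + rewrite !scale_row_mx add_row_mx; congr row_mx.
      rewrite mulmxDl -!scalemxAl; move: (v *m J) (v' *m J) => a a'.
      by apply/rowP => i; rewrite !mxE; ring.
    by apply/rowP => i; rewrite !mxE dotDr !dotZr; ring.
- move=> [v [w [z [s [Cw pz s0]]]]]; rewrite -row_mx0 => /eq_row_mx[h1 h2].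
  have : 0 <= dot c v + alpha.
    apply: (primal v w Cw); suff -> : v *m J + q - w = z by exact: pz.
    by apply/eqP; rewrite -subr_eq0 -h1.
  have /rowP/(_ ord0) := h2; rewrite !mxE => h3 h4.
  by move: h3 h4 s0; clear; lra.
- exists (row_mx (0 *m J + q - w0 - 0) (const_mx (dot c 0 + alpha + 1))).
  by exists 0, w0, 0, 1.
pose l := lsubmx xi; pose mu := rsubmx xi ord0 ord0.
have ineq v w z s : C w -> polar z -> 0 < s ->
    0 <= dot l (v *m J + q - w - z) + mu * (dot c v + alpha + s).
  move=> Cw pz s0; have := xiE _ (ex_intro _ v (ex_intro _ w (ex_intro _ z
    (ex_intro _ s (And4 Cw pz s0 erefl))))).
  rewrite -[xi]hsubmxK dot_row_mx -/l; congr (_ <= _ + _).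
  by rewrite /dot big_ord1 [X in _ * X = _]mxE.
(* Letting [s], the multiple of [z] and the multiple of [v] grow in [ineq] gives
   the sign of [mu], the membership of [l] in [K] and stationarity. *)
have mu0 : 0 <= mu.
  apply: (@ge0_of_large (dot l (0 *m J + q - w0 - 0) + mu * (dot c 0 + alpha))).
  move=> s s0; have := ineq 0 w0 0 s Cw0 polar0 s0.
  by rewrite [mu * (_ + s)]mulrDr addrA [mu * s]mulrC.
have Kl : K l.
  apply: bipolar => // z pz; rewrite -oppr_ge0.
  apply: (@ge0_of_large (dot l (0 *m J + q - w0) + mu * (dot c 0 + alpha + 1))).
  move=> s s0; have pz' : polar (s *: z).
    by move=> x Kx; rewrite dotZr pmulr_rle0// pz.
  have := ineq 0 w0 _ 1 Cw0 pz' ltr01; rewrite dotBr dotZr.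
  by rewrite mulrN addrAC.
have stat : mu *: c + l *m J^T = 0.
  set u := mu *: c + l *m J^T; apply/eqP; rewrite -dot_eq0 eq_le dot_ge0 andbT.
  rewrite -oppr_ge0.
  apply: (@ge0_of_large (dot l (q - w0) + mu * (alpha + 1))) => s s0.
  have := ineq (- s *: u) w0 0 1 Cw0 polar0 ltr01.
  have -> : dot u u = mu * dot c u + dot l (u *m J).
    by rewrite {1}/u dotDl dotZl (dotC (l *m _)) -dot_mulmx (dotC l).
  rewrite subr0 -scalemxAl -(addrA _ q) dotDr !dotZr.
  by congr (_ <= _); ring.
have mu_gt0 : 0 < mu.
  rewrite lt0r mu0 andbT; apply: contra_neq xi0 => muE.
  move: stat; rewrite muE scale0r add0r => /(cq _ Kl) lE.
  rewrite -[xi]hsubmxK -/l lE (_ : rsubmx xi = 0) ?row_mx0//.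
  by apply/rowP => i; rewrite (ord1 i) -/mu muE mxE.
have muV : 0 < mu^-1 by rewrite invr_gt0.
exists (mu^-1 *: l); first exact: Kcone.
split.
  rewrite -scalemxAl -[X in X + _](scalerK (lt0r_neq0 mu_gt0)).
  by rewrite -scalerDr stat scaler0.
move=> w Cw; rewrite !dotZl -(ler_pM2l mu_gt0) mulrDr !mulVKf ?gt_eqF//.
rewrite -subr_le0; apply: (@ler_small_step _ _ mu 1) => // s s0 _.
have := ineq 0 w 0 s Cw polar0 s0.
by rewrite mul0mx add0r subr0 dot0r add0r dotBr; lra.
Qed.

End ConvexDuality.

(** * The directional Clarke normal cone *)

Section ClarkeNormalCone.
Context {R : realType} {n : nat}.
Implicit Types (S : set 'rV[R]_n) (a w : 'rV[R]_n).

Lemma closure_radiusP (A : set 'rV[R]_n) x :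
  closure A x <-> forall e, 0 < e -> exists2 y, A y & `|y - x| < e.
Proof.
split=> [clA e e0|clA B /(near_radiusP x _).1 [e e0 eB]].
  have [|y [Ay yx]] := clA [set y | `|y - x| < e]; last by exists y.
  by apply: (near_radiusP x _).2; exists e.
by have [y Ay yx] := clA e e0; exists y; split=> //; exact: eB.
Qed.

Lemma sub_convex_hull S : S `<=` convex_hull S.
Proof. exact: sub_gen_smallest. Qed.

Lemma convex_hull_convex S x y t :
  convex_hull S x -> convex_hull S y -> 0 <= t <= 1 ->
  convex_hull S (t *: x + (1 - t) *: y).
Proof.
move=> Sx Sy t01 A CA; have [/convex_setP cA _] := CA.
by apply: cA => //; [exact: (Sx A CA)|exact: (Sy A CA)].
Qed.

Lemma convex_hull_cone S c :
  (forall x, S x -> S (c *: x)) -> forall x, convex_hull S x -> convex_hull S (c *: x).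
Proof.
move=> Sc x /(_ [set y | convex_hull S (c *: y)]); apply.
split; last by move=> y Sy; apply: sub_convex_hull; exact: Sc.
apply/convex_setP => y z t /= hy hz t01.
rewrite scalerDr !scalerA ![c * _]mulrC -!scalerA.
exact: convex_hull_convex.
Qed.

Lemma dir_normal_cone S a w c l :
  0 < c -> dir_normal S a w l -> dir_normal S a w (c *: l).
Proof.
move=> c0 [t [dk [vk [t0 dkd vkl Sv]]]].
exists t, dk, (fun k => c *: vk k); split=> //; first exact: cvgZr.
by move=> k; exact: regular_normalZ.
Qed.

Lemma clarke_cone S a w c l :
  0 < c -> dir_clarke_normal S a w l -> dir_clarke_normal S a w (c *: l).
Proof.
move=> c0 /closure_radiusP clS; apply/closure_radiusP => e e0.
have [y Sy yl] := clS (e / c) (divr_gt0 e0 c0).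
exists (c *: y); first by apply: convex_hull_cone Sy => x; exact: dir_normal_cone.
by rewrite -scalerBr normrZ gtr0_norm// mulrC -ltr_pdivlMr.
Qed.

Lemma clarke_convex S a w x y t :
  dir_clarke_normal S a w x -> dir_clarke_normal S a w y -> 0 <= t <= 1 ->
  dir_clarke_normal S a w (t *: x + (1 - t) *: y).
Proof.
move=> /closure_radiusP Sx /closure_radiusP Sy t01.
apply/closure_radiusP => e e0; have /andP[t0 t1] := t01.
have e2 : 0 < e / 2 by rewrite divr_gt0.
have [x' Sx' x'x] := Sx _ e2; have [y' Sy' y'y] := Sy _ e2.
exists (t *: x' + (1 - t) *: y'); first exact: convex_hull_convex.
have -> : t *: x' + (1 - t) *: y' - (t *: x + (1 - t) *: y) =
    t *: (x' - x) + (1 - t) *: (y' - y).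
  by apply/rowP => i; rewrite !mxE; ring.
rewrite (le_lt_trans (ler_normD _ _))// !normrZ !ger0_norm ?subr_ge0//.
rewrite (splitr e); apply: ltrD; [apply: le_lt_trans x'x|apply: le_lt_trans y'y].
  by rewrite ler_piMl.
by rewrite ler_piMl// gerBl.
Qed.

Lemma sub_dir_clarke S a w : dir_normal S a w `<=` dir_clarke_normal S a w.
Proof. by move=> l Sl; apply: subset_closure; exact: sub_convex_hull. Qed.

Lemma dir_normal0 S a w : tangent_cone S a w -> dir_normal S a w 0.
Proof.
move=> [t [dk [t0 dkw Sk]]]; exists t, dk, (fun=> 0); split=> //.
  exact: cvg_cst.
move=> k; split=> // e e0; apply: (near_radiusP _ _).2; exists 1 => // x _ _.
by rewrite dot0l mulr_ge0// ltW.
Qed.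

End ClarkeNormalCone.

(** * The Lagrangian *)

Section Lagrangian.
Context {R : realType} {n m : nat}.
Context (f : 'rV[R]_n -> R) (g : 'rV[R]_n -> 'rV[R]_m) (l : 'rV[R]_m).
Context (f2 : twice_cont_diff f) (g2 : twice_cont_diff g).

Lemma grad_lagrangianE : grad (fun x => lagrangian f g x l) =
  grad f + \sum_i (l ord0 i \*: grad (fun x => g x ord0 i)).
Proof.
have dgi i x : differentiable (fun x => g x ord0 i) x.
  by case: (twice_cont_diff_coord i x g2).
have [df _ _] := f2.
have -> : (fun x => lagrangian f g x l) =
    f + \sum_i (l ord0 i \*: (fun x => g x ord0 i) : 'rV[R]_n -> R).
  apply/funext => x; rewrite /lagrangian /dot !fctE fct_sumE; congr (_ + _).
  by apply: eq_bigr => i _; rewrite mulrC.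
apply/funext => x; apply/rowP => j.
rewrite mxE deriveD; last 2 first.
- exact: diff_derivable.
- by apply: derivable_sum => i; apply: derivableZ; exact: diff_derivable.
rewrite derive_sum => [|i]; last by apply: derivableZ; exact: diff_derivable.
rewrite !fctE fct_sumE !mxE summxE; congr (_ + _); apply: eq_bigr => i _.
rewrite deriveZ; last exact: diff_derivable.
by rewrite !mxE.
Qed.

Lemma grad_lagrangian x : grad (fun x => lagrangian f g x l) x =
  grad f x + l *m (jacobian g x)^T.
Proof.
rewrite grad_lagrangianE !fctE fct_sumE; congr (_ + _); apply/rowP => j.
rewrite summxE mxE; apply: eq_bigr => i _; rewrite !mxE; congr (_ * _).
have [dgi _] := twice_cont_diff_coord i x g2; rewrite deriveE//.
have [dg _ _] := g2; have [_ ->] := diff_coord i (dg x).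
by rewrite -mulmx_jacobian -rowE mxE.
Qed.

Lemma hess_lagrangian x d : dot (d *m hess (fun x => lagrangian f g x l) x) d =
  dot (d *m hess f x) d + dot l (hess_quad g x d).
Proof.
have dgg i : differentiable (grad (fun x => g x ord0 i)) x.
  by case: (twice_cont_diff_coord i x g2).
have [df ddf _] := f2.
have dgf := differentiable_grad df (fun v => ddf v x).
have dL : differentiable
    (grad f + \sum_i (l ord0 i \*: grad (fun x => g x ord0 i))) x.
  apply: differentiableD => //; apply: differentiable_sum => i.
  exact: differentiableZ.
pose G := grad f + \sum_i (l ord0 i \*: grad (fun x => g x ord0 i)).
have HE : d *m hess (fun x => lagrangian f g x l) x = 'D_d G x.
  by rewrite (deriveE d dL) -grad_lagrangianE; exact: mulmx_hess.
apply: (etrans (congr1 (fun u => dot u d) HE)); rewrite /G.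
rewrite deriveD; last 2 first.
- exact: diff_derivable.
- by apply: derivable_sum => i; apply: derivableZ; exact: diff_derivable.
rewrite derive_sum => [|i]; last by apply: derivableZ; exact: diff_derivable.
rewrite dotDl (deriveE d dgf) -mulmx_hess; congr (_ + _).
have -> : \sum_i 'D_d (l ord0 i \*: grad (fun x => g x ord0 i)) x =
    \sum_i l ord0 i *: (d *m hess (fun x => g x ord0 i) x).
  apply: eq_bigr => i _; rewrite deriveZ; last exact: diff_derivable.
  by rewrite (deriveE d (dgg i)) -mulmx_hess.
rewrite (big_morph (fun u => dot u d) (fun u v => dotDl u v d) (dot0l d)).
by apply: eq_bigr => i _; rewrite dotZl mxE.
Qed.

End Lagrangian.

(** * Existence of a common multiplier *)

Theorem corollary4 (R : realType) (n m : nat)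
    (f : 'rV[R]_n -> R) (g : 'rV[R]_n -> 'rV[R]_m) (Lam : set 'rV[R]_m)
    (xbar d : 'rV[R]_n)
    (f_C2 : twice_cont_diff f) (g_C2 : twice_cont_diff g)
    (Lam_closed : closed Lam)
    (xbar_opt : local_optimal f g Lam xbar)
    (d_crit : critical_cone f g Lam xbar d)
    (T2_neq0 : tangent_set2 Lam (g xbar) (d *m jacobian g xbar) !=set0)
    (rcq : dir_robinson_cq g Lam xbar d)
    (C : set 'rV[R]_m)
    (C_neq0 : C !=set0)
    (C_convex : @convex_set R 'rV[R]_m C)
    (C_sub : C `<=` tangent_set2 Lam (g xbar) (d *m jacobian g xbar)) :
  exists2 lam : 'rV[R]_m, dir_clarke_multipliers f g Lam xbar d lam &
    (0 <= (dot (d *m hess (fun x => lagrangian f g x lam) xbar) d)%:E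
          - support_fun C lam)%E.
Proof.
set J := jacobian g xbar in T2_neq0 C_sub *.
set K := dir_clarke_normal Lam (g xbar) (d *m J).
have [d_tan cd] := d_crit.
have K0 : K !=set0 by exists 0; exact/sub_dir_clarke/dir_normal0.
have [|||l Kl [stat lC]] := @conic_multiplier R n m J K C (hess_quad g xbar d)
  (grad f xbar) (dot (d *m hess f xbar) d) (@closed_closure _ _) K0
  (fun x y t => @clarke_convex _ _ _ _ _ x y t)
  (fun x c => @clarke_cone _ _ _ _ _ c x) _ C_neq0.
- by move=> l Kl lJ; exact: rcq.
- exact/convex_setP.
- move=> v w Cw zpol.
  apply: (primal_second_order f_C2 g_C2 Lam_closed xbar_opt cd _ (C_sub _ Cw)).
    by move=> l /sub_dir_clarke Kl lJ; exact: rcq.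
  by move=> l /sub_dir_clarke; exact: zpol.
exists l; first by split=> //; rewrite grad_lagrangian.
rewrite hess_lagrangian// sube_ge0; last by rewrite fin_numE orbT.
apply: ge_ereal_sup => _ [w Cw <-]; rewrite lee_fin addrC.
exact: lC.
Qed.
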